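(* The Efficient Domination problem is NP-complete for bipartite graphs with diameter at most $6$.
   Context: For a graph $G=(V,E)$ and $v\in V$, $N[v]$ is the closed neighborhood of $v$. A set $D\subseteq V$ is an efficient dominating set (e.d.s.) if $|N[v]\cap D|=1$ for every $v\in V$; the Efficient Domination problem asks, given a graph $G$, whether $G$ has an e.d.s. The diameter of a connected graph is the maximum distance between two of its vertices. *)

(* Defs.v *)
From mathcomp Require Import all_boot ssralg poly.

Set Implicit Arguments.
Unset Strict Implicit.
Unset Printing Implicit Defensive.

(** * Deterministic multitape Turing machines *)

Inductive move := MoveLeft | Stay | MoveRight.

Section Tape.
Variable A : Type.

(* A two-way infinite tape whose cells hold [None] (blank) or a symbol of [A].
   [tape_right] starts with the scanned cell; [tape_left] lists the cells to
   its left, nearest first; every cell beyond the two lists is blank. *)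
Record tape := Tape { tape_left : seq (option A); tape_right : seq (option A) }.

Definition scanned (t : tape) : option A := head None (tape_right t).

Definition write (a : option A) (t : tape) : tape :=
  Tape (tape_left t) (a :: behead (tape_right t)).

Definition shift (m : move) (t : tape) : tape :=
  match m with
  | MoveLeft =>
      Tape (behead (tape_left t)) (head None (tape_left t) :: tape_right t)
  | Stay => t
  | MoveRight => Tape (scanned t :: tape_left t) (behead (tape_right t))
  end.

End Tape.

(* [tm S] is a machine with input alphabet [S] and [ntapes.+1] tapes; its tape
   alphabet consists of the blank, the input symbols [inl s] and finitely many
   work symbols [inr a]. *)
Record tm (S : finType) := TM {
  ntapes : nat;
  work : finType;
  state : finType;
  start : state;
  halting : pred state;
  accepting : pred state;
  delta : state -> {ffun 'I_ntapes.+1 -> option (S + work)} ->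
          state * {ffun 'I_ntapes.+1 -> option (S + work) * move}
}.

Section Run.
Variables (S : finType) (M : tm S).

Definition config : Type :=
  state M * {ffun 'I_(ntapes M).+1 -> tape (S + work M)}.

Definition written (w : seq S) : seq (option (S + work M)) :=
  [seq Some (inl s) | s <- w].

Definition init (w : seq S) : config :=
  (start M,
   [ffun i => Tape [::] (if i == ord0 then written w else [::])]).

Definition step (c : config) : config :=
  if halting c.1 then c else
  let: (q, act) := delta c.1 [ffun i => scanned (c.2 i)] in
  (q, [ffun i => shift (act i).2 (write (act i).1 (c.2 i))]).

Definition run (n : nat) (w : seq S) : config := iter n step (init w).

(* From the scanned cell rightwards the tape reads [w], then blanks forever. *)
Definition holds_word (t : tape (S + work M)) (w : seq S) : Prop :=
  forall i, nth None (tape_right t) i = nth None (written w) i.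

End Run.

(** * Polynomial time, NP and NP-completeness *)

(* [step] fixes halting configurations, so [halting (run M n w).1] means that
   [M] halts on [w] after at most [n] steps. *)
Definition decides_in (S : finType) (M : tm S) (L : seq S -> Prop)
    (time : nat -> nat) : Prop :=
  forall w : seq S, let c := run M (time (size w)) w in
    halting c.1 /\ (accepting c.1 <-> L w).

Definition computes_in (S : finType) (M : tm S) (f : seq S -> seq S)
    (time : nat -> nat) : Prop :=
  forall w : seq S, let c := run M (time (size w)) w in
    halting c.1 /\ holds_word (c.2 ord_max) (f w).

Definition in_P (S : finType) (L : seq S -> Prop) : Prop :=
  exists (M : tm S) (p : {poly nat}), decides_in M L (horner p).

Definition poly_time (S : finType) (f : seq S -> seq S) : Prop :=
  exists (M : tm S) (p : {poly nat}), computes_in M f (horner p).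

(* The pair (x, y) as the word x # y, where the separator # is [None]. *)
Definition pair_word (x y : seq bool) : seq (option bool) :=
  map some x ++ None :: map some y.

Definition in_NP (L : seq bool -> Prop) : Prop :=
  exists (R : seq (option bool) -> Prop) (p : {poly nat}),
    in_P R /\
    forall x, L x <-> exists y, size y <= horner p (size x) /\ R (pair_word x y).

Record problem := Problem {
  instance : Type;
  encode : instance -> seq bool;
  yes : instance -> Prop
}.

Definition language (P : problem) (w : seq bool) : Prop :=
  exists i : instance P, encode i = w /\ yes i.

(* The reduction must send every word to the code of an actual instance. *)
Definition reduces_to (L : seq bool -> Prop) (P : problem) : Prop :=
  exists f : seq bool -> seq bool, poly_time f /\
    forall w, exists i : instance P, encode i = f w /\ (L w <-> yes i).

Definition NP_hard (P : problem) : Prop := forall L, in_NP L -> reduces_to L P.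

Definition NP_complete (P : problem) : Prop := in_NP (language P) /\ NP_hard P.

Definition restrict (P : problem) (C : instance P -> Prop) : problem :=
  {| instance := {i : instance P | C i};
     encode := fun i => encode (sval i);
     yes := fun i => yes (sval i) |}.

(** * Graphs *)

Record sgraph := SGraph {
  vertex :> finType;
  adj : rel vertex;
  adj_sym : symmetric adj;
  adj_irrefl : irreflexive adj
}.

(* 1^n 0 followed by the n x n adjacency matrix, row by row. *)
Definition encode_graph (G : sgraph) : seq bool :=
  nseq #|G| true ++ false :: [seq adj x y | x <- enum G, y <- enum G].

Definition bipartite (G : sgraph) : Prop :=
  exists A : {set G}, forall x y : G, adj x y -> (x \in A) != (y \in A).

Definition connected (G : sgraph) : Prop :=
  0 < #|G| /\ forall x y : G, connect (@adj G) x y.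

(* The least length of a walk from x to y; it is #|G| if there is none. *)
Definition dist (G : sgraph) (x y : G) : nat :=
  find (fun k => [exists p : k.-tuple G, path (@adj G) x p && (last x p == y)])
       (iota 0 #|G|).

Definition diameter (G : sgraph) : nat :=
  \max_(x : G) \max_(y : G) dist x y.

Definition closed_nbhd (G : sgraph) (v : G) : {set G} :=
  [set u | (u == v) || adj v u].

Definition efficient_dominating (G : sgraph) (D : {set G}) : Prop :=
  forall v : G, #|closed_nbhd v :&: D| = 1.

Definition efficient_domination : problem :=
  {| instance := sgraph;
     encode := encode_graph;
     yes := fun G => exists D : {set G}, efficient_dominating D |}.

(* Main.v *)
(** Membership in NP: the certificate is an efficient dominating set together
    with a bipartition, and the diameter bound is tested by looking for walks of
    six steps, each of which may stay in place.

    Hardness: an exact cover instance (elements, sets) yields a bipartite graph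
    with a vertex for each element and each set and a pendant vertex at each set.
    If every element lies in a set, then the two vertices of a pendant edge force
    exactly one of them to be chosen, so no element is chosen, and the efficient
    dominating sets are the exact covers.  If moreover some hub set meets every
    set, all vertices are at distance at most 3 from the hub.

    A bounded computation of a nondeterministic multitape machine is a tiling of
    a rectangle whose columns are counted from the heads.  A tiling is an exact
    cover: on each edge of the grid, the tile on one side covers its own colour
    and the tile on the other side covers all colours but its own.

    Polynomial time is obtained from a small language of arithmetic expressions
    with bounded sums, whose values and evaluation costs are always polynomially
    bounded.  Expressions are compiled to machines whose tapes are unary counters;
    the verifier is one expression, and the adjacency matrix of the reduction is
    printed by nested loops over expressions. *)

Require Import Defs.
From mathcomp Require Import all_boot ssralg poly ssrint zify.

Set Implicit Arguments.
Unset Strict Implicit.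
Unset Printing Implicit Defensive.

Import GRing.Theory.

(** * Machine fragments *)

Section TapeView.
Variable A : Type.
Implicit Types t : tape A.

(** Tapes that differ only by trailing blanks in their lists have the same [view], so invariants
    speak of views. Cell 0 is the scanned one. *)
Definition view t (z : int) : option A :=
  match z with
  | Posz n => nth None (tape_right t) n
  | Negz n => nth None (tape_left t) n
  end.

Definition offset (m : move) : int :=
  match m with MoveLeft => Negz 0 | Stay => Posz 0 | MoveRight => Posz 1 end.

Lemma scanned_view t : scanned t = view t 0.
Proof. by rewrite /scanned /= nth0. Qed.

Lemma view_write a t z : view (write a t) z = if z == 0%R then a else view t z.
Proof. by case: z => [[|n]|n] //=; rewrite nth_behead. Qed.

Lemma view_shift m t z : view (shift m t) z = view t (z + offset m)%R.
Proof.
case: m => /=; last 2 first.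
- by rewrite addr0.
- case: z => [n|[|n]] /=.
  + by rewrite nth_behead; congr nth; lia.
  + by rewrite /scanned -nth0.
  + by congr nth; lia.
case: z => [[|n]|n] /=.
- by rewrite nth0.
- by congr nth; lia.
- by rewrite nth_behead; congr nth; lia.
Qed.

End TapeView.

Section Fragment.
Variables (S : finType) (K : nat).
Local Notation sym := (option (S + unit)).
Local Notation syms := {ffun 'I_K.+1 -> sym}.
Local Notation acts := {ffun 'I_K.+1 -> sym * move}.
Local Notation tapes := {ffun 'I_K.+1 -> tape (S + unit)}.

(* A fragment exits where [fdelta] is [None], so that a continuation can take over. *)
Record frag := Frag {
  fstate : finType;
  fstart : fstate;
  fdelta : fstate -> syms -> option (fstate * acts)
}.

Definition scan (t : tapes) : syms := [ffun i => scanned (t i)].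
Definition perform (a : acts) (t : tapes) : tapes :=
  [ffun i => shift (a i).2 (write (a i).1 (t i))].
Definition keep (s : syms) : acts := [ffun i => (s i, Stay)].

Definition fstep (F : frag) (c : fstate F * tapes) : fstate F * tapes :=
  if fdelta c.1 (scan c.2) is Some (q, a) then (q, perform a c.2) else c.

(** [fstep] is stationary once [fdelta] is [None], so [n] is only an upper bound on the time. *)
Definition exits (F : frag) n t t' :=
  exists q, iter n (@fstep F) (fstart F, t) = (q, t') /\ fdelta q (scan t') = None.

Definition word_at (u : seq sym) (z : int) : sym :=
  if z is Posz n then nth None u n else None.

(** A word and the head position relative to its first letter; the position is an integer because
    the head may stand left of the word. *)
Definition content := 'I_K.+1 -> seq sym * int.
Implicit Types T : content.

Definition shows T (t : tapes) :=
  forall i z, view (t i) z = word_at (T i).1 (z + (T i).2)%R.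

Definition look T : syms := [ffun i => word_at (T i).1 (T i).2].

Definition runs (F : frag) n T T' :=
  forall t, shows T t -> exists2 t', exits F n t t' & shows T' t'.

Lemma scan_shows T t : shows T t -> scan t = look T.
Proof. by move=> Tt; apply/ffunP=> i; rewrite !ffunE scanned_view Tt add0r. Qed.

Lemma shows_ext T T' t : T =1 T' -> shows T t -> shows T' t.
Proof. by move=> e Tt i z; rewrite Tt e. Qed.

Lemma runs_ext F n T1 T2 T1' T2' :
  runs F n T1 T2 -> T1 =1 T1' -> T2 =1 T2' -> runs F n T1' T2'.
Proof.
move=> r e1 e2 t /(shows_ext (fsym e1)) /r [t' ex /(shows_ext e2) sh].
by exists t'.
Qed.

Lemma perform_keep T t : shows T t -> shows T (perform (keep (scan t)) t).
Proof.
move=> Tt i z; rewrite !ffunE /= view_write -Tt scanned_view.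
by case: eqP => [->|].
Qed.

Lemma fstep_exit (F : frag) (q : fstate F) t n :
  fdelta q (scan t) = None -> iter n (@fstep F) (q, t) = (q, t).
Proof. by move=> e; elim: n => //= n ->; rewrite /fstep /= e. Qed.

Lemma exits_leq F n m t t' : n <= m -> exits F n t t' -> exits F m t t'.
Proof.
move=> /subnK <- [q [e x]]; exists q; split=> //.
by rewrite iterD e fstep_exit.
Qed.

Lemma runs_leq F n m T T' : n <= m -> runs F n T T' -> runs F m T T'.
Proof.
move=> nm r t /r [t' x sh]; exists t' => //.
exact: exits_leq nm x.
Qed.

(** After its exit [F] idles, whereas [G] may go on; hence only the genuine steps of [F], some
    [m <= n], are simulated. *)
Lemma embed (F G : frag) (h : fstate F -> fstate G) :
  (forall q s q' a, fdelta q s = Some (q', a) -> fdelta (h q) s = Some (h q', a)) ->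
  forall n q t q' t', iter n (@fstep F) (q, t) = (q', t') ->
    fdelta q' (scan t') = None ->
    exists2 m, m <= n & iter m (@fstep G) (h q, t) = (h q', t').
Proof.
move=> hF; elim=> [|n IH] q t q' t' e x.
  by case: e => -> ->; exists 0.
move: e; rewrite iterSr {2}/fstep /=; case D: (fdelta q (scan t)) => [[q1 a]|].
  move=> /IH/(_ x) [m mn e]; exists m.+1 => //.
  by rewrite iterSr {2}/fstep /= (hF _ _ _ _ D).
by rewrite fstep_exit // => -[<- <-]; exists 0.
Qed.

Definition fskip : frag := @Frag unit tt (fun _ _ => None).

Lemma runs_skip T : runs fskip 0 T T.
Proof. by move=> t Tt; exists t => //; exists tt. Qed.

Definition fact (g : syms -> acts) : frag :=
  @Frag bool false (fun q s => if q then None else Some (true, g s)).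

Lemma exits_act g t : exits (fact g) 1 t (perform (g (scan t)) t).
Proof. by exists true; split. Qed.

(** Handing over from [F] to [G] is a step of its own that rewrites the scanned symbols. It
    preserves views, though possibly not the lists representing the tapes. *)
Definition fseq (F G : frag) : frag :=
  @Frag (fstate F + fstate G)%type (inl (fstart F)) (fun q s =>
    match q with
    | inl q => if fdelta q s is Some (q', a) then Some (inl q', a)
               else Some (inr (fstart G), keep s)
    | inr q => omap (fun r => (inr r.1, r.2)) (fdelta q s)
    end).

Lemma exits_trans_seq F G n1 n2 t t1 t2 :
  exits F n1 t t1 -> exits G n2 (perform (keep (scan t1)) t1) t2 ->
  exits (fseq F G) (n1 + n2).+1 t t2.
Proof.
move=> [q1 [e1 x1]] [q2 [e2 x2]].
have hF q s q' a : fdelta q s = Some (q', a) ->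
  @fdelta (fseq F G) (inl q) s = Some (inl q', a) by move=> /= ->.
have hG q s q' a : fdelta q s = Some (q', a) ->
  @fdelta (fseq F G) (inr q) s = Some (inr q', a) by move=> /= ->.
have [m1 l1 E1] := embed hF e1 x1.
have [m2 l2 E2] := embed hG e2 x2.
apply: (@exits_leq _ (m2 + 1 + m1)); first by lia.
exists (inr q2); split; last by rewrite /= x2.
by rewrite !iterD E1 /= {2}/fstep /= x1 E2.
Qed.

Lemma runs_seq F G n1 n2 T T1 T2 :
  runs F n1 T T1 -> runs G n2 T1 T2 -> runs (fseq F G) (n1 + n2).+1 T T2.
Proof.
move=> r1 r2 t /r1 [t1 x1 /perform_keep/r2 [t2 x2 sh2]].
exists t2 => //; exact: exits_trans_seq x1 x2.
Qed.

Definition fwhile (b : pred syms) (F : frag) : frag :=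
  @Frag (option (fstate F)) None (fun q s =>
    match q with
    | None => if b s then Some (Some (fstart F), keep s) else None
    | Some q => if fdelta q s is Some (q', a) then Some (Some q', a)
                else Some (None, keep s)
    end).

Lemma runs_while0 (b : pred syms) F T : ~~ b (look T) -> runs (fwhile b F) 0 T T.
Proof.
move=> nb t Tt; exists t => //; exists None; split=> //=.
by rewrite (scan_shows Tt) (negbTE nb).
Qed.

Lemma runs_whileS (b : pred syms) F n1 n2 T T1 T2 : b (look T) ->
  runs F n1 T T1 -> runs (fwhile b F) n2 T1 T2 ->
  runs (fwhile b F) (n1 + n2).+2 T T2.
Proof.
move=> bT r1 r2 t Tt.
have [t1 [q1 [e1 x1]] /perform_keep/r2 [t2 [q2 [e2 x2]] sh2]] := r1 _ (perform_keep Tt).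
exists t2 => //.
have hF q s q' a : fdelta q s = Some (q', a) ->
  @fdelta (fwhile b F) (Some q) s = Some (Some q', a) by move=> /= ->.
have [m1 l1 E1] := embed hF e1 x1.
apply: (@exits_leq _ (n2 + 1 + m1 + 1)); first by lia.
exists q2; split=> //.
have s0 : @fstep (fwhile b F) (None, t) =
    (Some (fstart F), perform (keep (scan t)) t).
  by rewrite /fstep /= (scan_shows Tt) bT.
have s1 : @fstep (fwhile b F) (Some q1, t1) = (None, perform (keep (scan t1)) t1).
  by rewrite /fstep /= x1.
by rewrite addn1 iterSr s0 !iterD E1 [iter 1 _ _]s1 e2.
Qed.

(** Each pass pays two steps beyond its body, one to enter it and one to return to the test. *)
Lemma runs_loop (b : pred syms) F m k (T : nat -> content) :
  (forall i, i < k -> b (look (T i)) /\ runs F m (T i) (T i.+1)) ->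
  ~~ b (look (T k)) -> runs (fwhile b F) (k * m.+2) (T 0) (T k).
Proof.
elim: k T => [|k IH] T body last; first by rewrite mul0n; apply: runs_while0.
have [b0 r0] := body 0 isT.
rewrite mulSn; apply: (runs_whileS b0 r0).
by apply: (IH (fun i => T i.+1)) => // i ik; apply: body.
Qed.

Definition fif (b : pred syms) (F G : frag) : frag :=
  @Frag (option (fstate F + fstate G)) None (fun q s =>
    match q with
    | None => Some (Some (if b s then inl (fstart F) else inr (fstart G)), keep s)
    | Some (inl q) => omap (fun r => (Some (inl r.1), r.2)) (fdelta q s)
    | Some (inr q) => omap (fun r => (Some (inr r.1), r.2)) (fdelta q s)
    end).

Lemma runs_if (b : pred syms) F G n T T1 :
  runs (if b (look T) then F else G) n T T1 -> runs (fif b F G) n.+1 T T1.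
Proof.
move=> r t Tt; have [t1 [q [e x]] sh] := r _ (perform_keep Tt).
exists t1 => //.
have hF q1 s q' a : fdelta q1 s = Some (q', a) ->
  @fdelta (fif b F G) (Some (inl q1)) s = Some (Some (inl q'), a) by move=> /= ->.
have hG q1 s q' a : fdelta q1 s = Some (q', a) ->
  @fdelta (fif b F G) (Some (inr q1)) s = Some (Some (inr q'), a) by move=> /= ->.
case E: (b (look T)) q e x {r} => q e x.
- have [m l E1] := embed hF e x.
  apply: (@exits_leq _ m.+1) => //; exists (Some (inl q)); split; last by rewrite /= x.
  by rewrite iterSr {2}/fstep /= (scan_shows Tt) E -(scan_shows Tt).
- have [m l E1] := embed hG e x.
  apply: (@exits_leq _ m.+1) => //; exists (Some (inr q)); split; last by rewrite /= x.
  by rewrite iterSr {2}/fstep /= (scan_shows Tt) E -(scan_shows Tt).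
Qed.

Definition set_tape T i c : content := fun j => if j == i then c else T j.

Definition fon i (h : sym -> sym * move) : frag :=
  fact (fun s => [ffun j => if j == i then h (s i) else (s j, Stay)]).

Lemma runs_on i h T u p :
  let a := h (word_at (T i).1 (T i).2) in
  (forall z, (if (z + offset a.2 == 0)%R then a.1
              else word_at (T i).1 (z + offset a.2 + (T i).2)%R) = word_at u (z + p)%R) ->
  runs (fon i h) 1 T (set_tape T i (u, p)).
Proof.
move=> a H t Tt; eexists; first exact: exits_act.
move=> j z; rewrite !ffunE /set_tape view_shift view_write.
have [->|_] /= := eqVneq j i.
  by rewrite scanned_view Tt add0r -/a -H Tt.
rewrite addr0 -Tt scanned_view.
by case: eqP => // ->.
Qed.

Definition fmove i m : frag := fon i (fun s => (s, m)).

Lemma runs_move i m T :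
  runs (fmove i m) 1 T (set_tape T i ((T i).1, (T i).2 + offset m)%R).
Proof.
apply: runs_on => z /=; case: eqP => [e|_]; last by congr word_at; lia.
by congr word_at; lia.
Qed.

End Fragment.

(** * Arithmetic expressions compiled to machines *)

(** The base is at least 2, so constants and sums are absorbed into the exponent, which gives
    closure under sum, product and composition. *)
Definition poly_bounded (f : nat -> nat) := exists c, forall n, f n <= (n + 2) ^ c.

Lemma poly_bounded_cst k : poly_bounded (fun=> k).
Proof.
exists k => n; apply: leq_trans (ltnW (ltn_expl k (ltnSn 1))) _.
by case: k => [|k]; rewrite ?expn0 // leq_exp2r // leq_addl.
Qed.

Lemma poly_bounded_id : poly_bounded id.
Proof. by exists 1 => n; rewrite expn1 leq_addr. Qed.

Lemma poly_bounded_mul f g :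
  poly_bounded f -> poly_bounded g -> poly_bounded (fun n => f n * g n).
Proof. by move=> [a Ha] [b Hb]; exists (a + b) => n; rewrite expnD leq_mul. Qed.

Lemma poly_bounded_add f g :
  poly_bounded f -> poly_bounded g -> poly_bounded (fun n => f n + g n).
Proof.
move=> [a Ha] [b Hb]; exists (a + b).+1 => n.
have P c : 0 < (n + 2) ^ c by rewrite expn_gt0 addn2.
have := Ha n; have := Hb n; have := P a; have := P b.
rewrite expnS expnD; move: ((n + 2) ^ a) ((n + 2) ^ b) => x y; nia.
Qed.

Lemma poly_bounded_comp f g :
  poly_bounded f -> poly_bounded g -> poly_bounded (fun n => f (g n)).
Proof.
move=> [a Ha] [b Hb]; exists ((b + 2) * a) => n.
apply: leq_trans (Ha _) _; rewrite expnM.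
case: a {Ha} => [|a]; first by rewrite !expn0.
rewrite leq_exp2r // expnD.
have P : 0 < (n + 2) ^ b by rewrite expn_gt0 addn2.
have := Hb n; move: P; move: ((n + 2) ^ b) => x; nia.
Qed.

Lemma poly_bounded_horner f : poly_bounded f ->
  exists p : {poly nat}, forall n, f n <= horner p n.
Proof.
move=> [c H]; exists (('X + (2%:P)) ^+ c)%R => n.
rewrite horner_exp hornerD hornerX hornerC.
by apply: leq_trans (H n) _; rewrite natrXE.
Qed.

Ltac poly_tac := repeat first
  [ assumption | exact: poly_bounded_id | exact: poly_bounded_cst
  | apply: poly_bounded_add | apply: poly_bounded_mul ].

Definition upd (s : nat -> nat) x v := fun y => if y == x then v else s y.

Ltac upd_tac :=
  let j := fresh "j" in
  move=> j; rewrite /upd; repeat (case: eqP => [?|?]; try subst => //); try lia.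

(** * Arithmetic expressions with bounded sums *)

Section Expr.
Variable S : Type.

Inductive expr :=
  | Var of nat
  | Cst of nat
  | Len
  | Add of expr & expr
  | Monus of expr & expr
  | Mul of expr & expr
  | Sum of nat & expr & expr
  | Sym of pred (option S) & expr.

Fixpoint eval (w : seq S) (e : expr) (s : nat -> nat) : nat :=
  match e with
  | Var x => s x
  | Cst n => n
  | Len => size w
  | Add a b => eval w a s + eval w b s
  | Monus a b => eval w a s - eval w b s
  | Mul a b => eval w a s * eval w b s
  | Sum x a b => \sum_(i < eval w a s) eval w b (upd s x i)
  | Sym P a => P (onth w (eval w a s))
  end.

Fixpoint nvars (e : expr) : nat :=
  match e with
  | Var x => x.+1
  | Cst _ | Len => 0
  | Add a b | Monus a b | Mul a b => maxn (nvars a) (nvars b)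
  | Sum x a b => maxn x.+1 (maxn (nvars a) (nvars b))
  | Sym _ a => nvars a
  end.

(** Only the registers below [V], those of the variables, are bounded by [B]; accumulators and
    scratch registers lie above and may grow. *)
Definition bounded V B (w : seq S) (s : nat -> nat) :=
  size w <= B /\ forall j, j < V -> s j <= B.

Lemma bounded_leq V B B' w s : B <= B' -> bounded V B w s -> bounded V B' w s.
Proof.
by move=> le [lw ls]; split=> [|j /ls]; [exact: leq_trans le|move/leq_trans; apply].
Qed.

Lemma bounded_upd V B w s x v : v <= B -> bounded V B w s -> bounded V B w (upd s x v).
Proof. by move=> le [lw ls]; split=> // j jV; rewrite /upd; case: eqP => // _; apply: ls. Qed.

Lemma eval_eq w e V s s' : nvars e <= V -> (forall j, j < V -> s j = s' j) ->
  eval w e s = eval w e s'.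
Proof.
elim: e s s' => [x|n||a IHa b IHb|a IHa b IHb|a IHa b IHb|x a IHa b IHb|P a IHa] s s' //=;
  rewrite ?geq_max.
- by move=> xV; apply.
- by move=> /andP[la lb] e; rewrite (IHa s s') // (IHb s s').
- by move=> /andP[la lb] e; rewrite (IHa s s') // (IHb s s').
- by move=> /andP[la lb] e; rewrite (IHa s s') // (IHb s s').
- move=> /and3P[xV la lb] e; rewrite (IHa s s') //.
  by apply: eq_bigr => i _; apply: IHb => // j jV; rewrite /upd e.
- by move=> la e; rewrite (IHa s s').
Qed.

Lemma eval_bound e V : nvars e <= V ->
  exists f, poly_bounded f /\ forall w s B, bounded V B w s -> eval w e s <= f B.
Proof.
elim: e => [x|n||a IHa b IHb|a IHa b IHb|a IHa b IHb|x a IHa b IHb|P a IHa] /=;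
  rewrite ?geq_max.
- move=> xV; exists id; split; first exact: poly_bounded_id.
  by move=> w s B [_]; apply.
- by move=> _; exists (fun=> n); split; first exact: poly_bounded_cst.
- by move=> _; exists id; split; [exact: poly_bounded_id|move=> w s B []].
- move=> /andP[/IHa[f [pf Hf]] /IHb[g [pg Hg]]].
  exists (fun n => f n + g n); split; first exact: poly_bounded_add.
  by move=> w s B h; apply: leq_add; [apply: Hf|apply: Hg].
- move=> /andP[/IHa[f [pf Hf]] _]; exists f; split=> // w s B h.
  by apply: leq_trans (leq_subr _ _) (Hf _ _ _ h).
- move=> /andP[/IHa[f [pf Hf]] /IHb[g [pg Hg]]].
  exists (fun n => f n * g n); split; first exact: poly_bounded_mul.
  by move=> w s B h; apply: leq_mul; [apply: Hf|apply: Hg].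
- move=> /and3P[xV /IHa[f [pf Hf]] /IHb[g [pg Hg]]].
  (* The summation variable stays below the value of [a], hence below [f B], so the body is
     evaluated under the bound [B + f B]. *)
  exists (fun n => f n * g (n + f n)); split.
    apply: poly_bounded_mul => //; apply: poly_bounded_comp => //.
    by apply: poly_bounded_add => //; exact: poly_bounded_id.
  move=> w s B h; have le := Hf _ _ _ h.
  apply: (@leq_trans (\sum_(i < eval w a s) g (B + f B))).
    apply: leq_sum => i _; apply: Hg.
    apply: bounded_upd; last by apply: bounded_leq h; rewrite leq_addr.
    by apply: leq_trans (ltnW (ltn_ord i)) _; apply: leq_trans le (leq_addl _ _).
  by rewrite sum_nat_const card_ord leq_mul2r le orbT.
- move=> /IHa _; exists (fun=> 1); split; first exact: poly_bounded_cst.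
  by move=> w s B _; case: (P _).
Qed.

(** How many registers from [d] upwards suffice for [compile d r e]. *)
Fixpoint scratch (e : expr) : nat :=
  match e with
  | Cst _ => 0
  | Var _ | Len => 1
  | Add a b => maxn (scratch a) (scratch b)
  | Monus a b | Sum _ a b => maxn (scratch a).+1 (scratch b).+2
  | Mul a b => (maxn (scratch a) (scratch b)).+1
  | Sym _ a => (scratch a).+2
  end.

End Expr.
Arguments Var {S}. Arguments Cst {S}. Arguments Len {S}.

(** * Tapes as unary counters *)

Section Registers.
Variables (S : finType) (R : nat).
Local Notation sym := (option (S + unit)).
Local Notation syms := {ffun 'I_R.+2 -> sym}.
Implicit Types (s : nat -> nat) (w o : seq S).

Definition mark : sym := Some (inr tt).

Definition reg r : 'I_R.+2 := inord r.+1.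

Definition out_tape o : seq sym := [seq Some (inl a) | a <- o].

(* Register r is the head position on tape r.+1, whose only mark is at its origin. *)
Definition conf w s p o : content S R.+1 := fun i =>
  if i == ord0 then (out_tape w, Posz p)
  else if i == ord_max then (out_tape o, Posz (size o))
  else ([:: mark], Posz (s i.-1)).

Lemma conf_ext w s s' p o : s =1 s' -> conf w s p o =1 conf w s' p o.
Proof. by move=> e i; rewrite /conf e. Qed.

Lemma val_reg r : r < R -> reg r = r.+1 :> nat.
Proof. by move=> h; rewrite inordK // !ltnS ltnW. Qed.

Lemma conf_reg w s p o r : r < R -> conf w s p o (reg r) = ([:: mark], Posz (s r)).
Proof.
move=> h; rewrite /conf -!(inj_eq val_inj) /= val_reg //=.
by rewrite ltn_eqF.
Qed.

Lemma set_tape_reg w s p o r v : r < R ->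
  set_tape (conf w s p o) (reg r) ([:: mark], Posz v) =1 conf w (upd s r v) p o.
Proof.
move=> h i; rewrite /set_tape /conf /upd -!(inj_eq val_inj) /= val_reg //.
case: i => -[|i] hi //=; rewrite !eqSS.
by case: (eqVneq i r) => [->|//]; rewrite (ltn_eqF h).
Qed.

Definition finc r : frag S R.+1 := fmove S (reg r) MoveRight.
(** The head does not move when it sees the origin mark, so the predecessor of 0 is 0, as truncated
    subtraction requires. *)
Definition fdec r : frag S R.+1 :=
  fon (reg r) (fun a => (a, if a == mark then Stay else MoveLeft)).
Definition fnext : frag S R.+1 := fmove S ord0 MoveRight.
Definition fprev : frag S R.+1 := fmove S ord0 MoveLeft.
Definition fout a : frag S R.+1 := fon ord_max (fun=> (Some (inl a), MoveRight)).
Definition nonzero r : pred syms := fun t => t (reg r) != mark.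
Definition insym (P : pred (option S)) : pred syms := fun t =>
  P (if t ord0 is Some (inl a) then Some a else None).

Lemma nonzeroE w s p o r : r < R -> nonzero r (look (conf w s p o)) = (s r != 0).
Proof.
move=> h; rewrite /nonzero ffunE conf_reg //=.
by case: (s r) => [|[|n]]; rewrite /= ?eqxx.
Qed.

Lemma nth_out_tape o i : nth None (out_tape o) i = omap inl (onth o i).
Proof. by elim: o i => [|a o IH] [|i] //=; rewrite IH. Qed.

Lemma insymE w s p o P : insym P (look (conf w s p o)) = P (onth w p).
Proof.
rewrite /insym ffunE /conf eqxx /= nth_out_tape.
by case: (onth w p).
Qed.

Lemma runs_inc r w s s' p o : r < R -> s' =1 upd s r (s r).+1 ->
  runs (finc r) 1 (conf w s p o) (conf w s' p o).
Proof.
move=> h /conf_ext e.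
apply: runs_ext (@runs_move S _ (reg r) MoveRight (conf w s p o)) _ _ => // i; rewrite e.
rewrite -(set_tape_reg _ _ _ _ _ h) conf_reg //=.
by have -> : (Posz (s r) + Posz 1)%R = Posz (s r).+1 by lia.
Qed.

Lemma runs_dec r w s s' p o : r < R -> s' =1 upd s r (s r).-1 ->
  runs (fdec r) 1 (conf w s p o) (conf w s' p o).
Proof.
move=> h /conf_ext e.
apply: runs_ext _ _ (fun i => etrans (set_tape_reg _ _ _ _ _ h i) (esym (e _ _ _ i))) => //.
apply: runs_on => z; rewrite conf_reg //=.
case: (s r) => [|n] /=.
  by rewrite !addr0; case: eqP => [->|].
rewrite (_ : nth None _ _ = None); last by case: n.
rewrite /=; case: eqP => z1.
  have -> : (z + Posz n)%R = Posz n.+1 by lia.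
  by rewrite /= nth_nil.
by congr word_at; lia.
Qed.

Lemma runs_next w s p o : runs fnext 1 (conf w s p o) (conf w s p.+1 o).
Proof.
apply: runs_ext (@runs_move S _ ord0 MoveRight (conf w s p o)) _ _ => // i.
rewrite /set_tape /conf eqxx /=.
by case: eqP => // _; congr pair; lia.
Qed.

Lemma runs_prev w s p o : runs fprev 1 (conf w s p.+1 o) (conf w s p o).
Proof.
apply: runs_ext (@runs_move S _ ord0 MoveLeft (conf w s p.+1 o)) _ _ => // i.
rewrite /set_tape /conf eqxx /=.
by case: eqP => // _; congr pair; lia.
Qed.

Lemma runs_out a w s p o : runs (fout a) 1 (conf w s p o) (conf w s p (rcons o a)).
Proof.
apply: (@runs_ext _ _ _ _ _
  (set_tape (conf w s p o) ord_max (out_tape (rcons o a), Posz (size (rcons o a))))) => //;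
  last first.
  by move=> i; rewrite /set_tape /conf; have [->|] := eqVneq i ord_max.
apply: runs_on => z; rewrite /= /conf -(inj_eq val_inj) /= eqxx size_rcons.
rewrite /out_tape map_rcons -/(out_tape o).
case: eqP => e.
  have -> : (z + Posz (size o).+1 = Posz (size o))%R by lia.
  by rewrite /= nth_rcons size_map ltnn eqxx.
rewrite (_ : z + 1%Z + size o = z + (size o).+1)%R; last by lia.
have : (z + Posz (size o).+1 != Posz (size o))%R by lia.
case: (z + _)%R => //= n ne; rewrite nth_rcons size_map.
case: ltngtP => // [l|e']; last by move: ne; rewrite e' eqxx.
by rewrite nth_default // size_map ltnW.
Qed.

Definition floop d F := fwhile (nonzero d) (fseq (fdec d) F).

(** The counter [d] is decremented before the body runs, so it holds [k - i.+1] during pass [i];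
    [f i] describes the other registers. The four extra steps are the test, the decrement, the
    hand-over and the return. *)
Lemma runs_floop d F m w (f : nat -> nat -> nat) p (o : nat -> seq S) k : d < R ->
  (forall i, i < k ->
    runs F m (conf w (upd (f i) d (k - i.+1)) (p i) (o i))
             (conf w (upd (f i.+1) d (k - i.+1)) (p i.+1) (o i.+1))) ->
  runs (floop d F) (k * m.+4) (conf w (upd (f 0) d k) (p 0) (o 0))
                              (conf w (upd (f k) d 0) (p k) (o k)).
Proof.
move=> h H.
have := @runs_loop S _ (nonzero d) (fseq (fdec d) F) m.+2 k
  (fun i => conf w (upd (f i) d (k - i)) (p i) (o i)).
rewrite /= subn0 subnn; apply.
  move=> i ik; split; first by rewrite nonzeroE // /upd eqxx -lt0n subn_gt0.
  rewrite -[m.+2]/((1 + m).+1); apply: runs_seq _ (H i ik).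
   by apply: runs_dec => //; upd_tac.
by rewrite nonzeroE // /upd eqxx.
Qed.

Definition fadd x y := floop x (finc y).

Lemma runs_fadd x y w s s' p o : x < R -> y < R -> x != y ->
  s' =1 upd (upd s y (s y + s x)) x 0 ->
  runs (fadd x y) (s x * 5) (conf w s p o) (conf w s' p o).
Proof.
move=> hx hy /eqP xy e.
have := @runs_floop x (finc y) 1 w (fun i => upd s y (s y + i)) (fun=> p) (fun=> o) (s x) hx.
move=> H; apply: runs_ext (H _) _ _.
- by move=> i ik; apply: runs_inc => //; upd_tac.
- by apply: conf_ext; upd_tac.
- by apply: conf_ext => j; rewrite e; move: j; upd_tac.
Qed.

Definition fclear x := floop x (@fskip S R.+1).

Lemma runs_fclear x w s s' p o : x < R -> s' =1 upd s x 0 ->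
  runs (fclear x) (s x * 4) (conf w s p o) (conf w s' p o).
Proof.
move=> hx e.
have := @runs_floop x (@fskip S R.+1) 0 w (fun i => s) (fun=> p) (fun=> o) (s x) hx.
move=> H; apply: runs_ext (H _) _ _.
- by move=> i ik; apply: runs_skip.
- by apply: conf_ext; upd_tac.
- by apply: conf_ext => j; rewrite e.
Qed.

(* The old value of x is saved in register d.+1. *)
Definition ffor d x A F :=
  fseq A (fseq (fadd x d.+1) (fseq (floop d (fseq F (finc x)))
    (fseq (fclear x) (fadd d.+1 x)))).

Lemma runs_ffor d x A F n m w s (f : nat -> nat -> nat) (o : nat -> seq S) k :
  x < d -> d.+1 < R -> s d = 0 -> s d.+1 = 0 -> f 0 =1 s ->
  runs A n (conf w s 0 (o 0)) (conf w (upd s d k) 0 (o 0)) ->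
  (forall i, i < k ->
    runs F m (conf w (upd (upd (upd (f i) d (k - i.+1)) d.+1 (s x)) x i) 0 (o i))
             (conf w (upd (upd (upd (f i.+1) d (k - i.+1)) d.+1 (s x)) x i) 0 (o i.+1))) ->
  runs (ffor d x A F) (n + s x * 10 + k * (m + 10) + 4)
    (conf w s 0 (o 0)) (conf w (upd (upd (upd (f k) d 0) d.+1 0) x (s x)) 0 (o k)).
Proof.
move=> xd dR sd sd1 f0 rA rF.
have [xR d0R] : x < R /\ d < R by lia.
have ne1 : x != d.+1 by lia.
have ne2 : x != d by lia.
(* While [d] counts down from [k], the loop variable [x] counts up from 0, with its old value kept
   in [d.+1]. *)
have rL : runs (floop d (fseq F (finc x))) (k * (m + 1).+1.+4)
    (conf w (upd (upd (upd s d.+1 (s x)) x 0) d k) 0 (o 0))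
    (conf w (upd (upd (upd (f k) d.+1 (s x)) x k) d 0) 0 (o k)).
  have := @runs_floop d (fseq F (finc x)) (m + 1).+1 w
    (fun i => upd (upd (f i) d.+1 (s x)) x i) (fun=> 0) o k d0R.
  move=> H; apply: runs_ext (H _) _ _ => //; last first.
    by apply: conf_ext => j; rewrite /upd f0.
  move=> i ik; apply: (@runs_seq _ _ _ _ _ _ _
    (conf w (upd (upd (upd (f i.+1) d (k - i.+1)) d.+1 (s x)) x i) 0 (o i.+1))).
    by apply: runs_ext (rF i ik) _ _ => //; apply: conf_ext; upd_tac.
  by apply: runs_inc => //; upd_tac.
apply: (@runs_leq _ _ _ (n + (s x * 5 + (k * (m + 1).+1.+4 +
  (k * 4 + s x * 5).+1).+1).+1).+1); first by nia.
apply: runs_seq rA _.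
apply: (@runs_seq _ _ _ _ _ _ _
  (conf w (upd (upd (upd s d.+1 (s x)) x 0) d k) 0 (o 0))).
  rewrite (_ : s x = upd s d k x); last by rewrite /upd (negbTE ne2).
  by apply: runs_fadd => //; upd_tac.
apply: runs_seq rL _.
apply: (@runs_seq _ _ _ _ _ _ _
  (conf w (upd (upd (upd (f k) d.+1 (s x)) x 0) d 0) 0 (o k))).
  rewrite [X in X * 4](_ : _ = upd (upd (upd (f k) d.+1 (s x)) x k) d 0 x); last first.
    by rewrite /upd (negbTE ne2) eqxx.
  by apply: runs_fclear => //; upd_tac.
rewrite [X in X * 5](_ : _ = upd (upd (upd (f k) d.+1 (s x)) x 0) d 0 d.+1); last first.
  by rewrite /upd gtn_eqF // eq_sym (negbTE ne1) eqxx.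
by apply: runs_fadd => //; first lia; upd_tac.
Qed.

(** The value is added to register [r] instead of being stored there, so sums, products and bounded
    sums merely repeat code with the same target. Registers from [d] on are scratch: zero before,
    zero again afterwards. Moving a counter destroys it, so [Var x] is first moved to [r] and [d]
    together, then restored from [d]. *)
Fixpoint compile d r (e : expr S) : frag S R.+1 :=
  match e with
  | Var x => fseq (floop x (fseq (finc r) (finc d))) (fadd d x)
  | Cst n => iter n (fseq (finc r)) (@fskip S R.+1)
  | Len => fseq (fwhile (insym isSome) (fseq fnext (finc d)))
                (floop d (fseq fprev (finc r)))
  | Add a b => fseq (compile d r a) (compile d r b)
  | Monus a b => fseq (compile d.+1 d a) (fseq (compile d.+2 d.+1 b)
                 (fseq (floop d.+1 (fdec d)) (fadd d r)))
  | Mul a b => fseq (compile d.+1 d a) (floop d (compile d.+1 r b))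
  | Sum x a b => ffor d x (compile d.+1 d a) (compile d.+2 r b)
  | Sym P a => fseq (compile d.+1 d a) (fseq (floop d (fseq fnext (finc d.+1)))
                 (fseq (fif (insym P) (finc r) (@fskip S R.+1)) (floop d.+1 fprev)))
  end.

(** The final configuration differs from the initial one in register [r] alone: scratch registers
    are cleared and the input head is back at 0, so fragments can be chained. *)
Definition comp_correct V e f :=
  forall d r w s o B, V <= r < d -> d + scratch e <= R ->
    (forall j, d <= j -> s j = 0) -> bounded V B w s ->
    runs (compile d r e) (f B) (conf w s 0 o) (conf w (upd s r (s r + eval w e s)) 0 o).

Lemma comp_var V x : x < V -> comp_correct V (Var x) (fun n => n * 20 + 1).
Proof.
move=> xV d r w s o B /andP[Vr rd] /=; rewrite addn1 => dR s0 [_ /(_ _ xV) sB].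
have [xR rR xd xr] : [/\ x < R, r < R, x < d & x < r] by split; lia.
have sd := s0 d (leqnn d).
apply: (@runs_leq _ _ _ (s x * 7 + s x * 5).+1); first by lia.
apply: (@runs_seq _ _ _ _ _ _ _ (conf w (upd (upd (upd s r (s r + s x)) d (s x)) x 0) 0 o)).
  have := @runs_floop x (fseq (finc r) (finc d)) 3 w
    (fun i => upd (upd s r (s r + i)) d i) (fun=> 0) (fun=> o) (s x) xR.
  move=> H; apply: runs_ext (H _) _ _ => //; last first.
    by apply: conf_ext; upd_tac.
  move=> i ik; apply: (@runs_seq _ _ _ _ 1 1 _
   (conf w (upd (upd (upd s r (s r + i.+1)) d i) x (s x - i.+1)) 0 o)).
    by apply: runs_inc => //; upd_tac.
  by apply: runs_inc => //; upd_tac.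
rewrite [X in X * 5](_ : _ = upd (upd (upd s r (s r + s x)) d (s x)) x 0 d); last first.
  by rewrite /upd gtn_eqF // eqxx.
by apply: runs_fadd => //; [lia|upd_tac].
Qed.

Lemma comp_cst V n : comp_correct V (Cst n) (fun=> n * 2).
Proof.
move=> d r w s o B /andP[Vr rd] /= dR s0 _.
elim: n s s0 => [|n IH] s s0 /=.
  rewrite mul0n. apply: runs_ext (@runs_skip _ _ _) _ _ => //; apply: conf_ext; upd_tac.
rewrite mulSn; apply: (@runs_leq _ _ _ (1 + n * 2).+1); first by lia.
apply: (@runs_seq _ _ _ _ _ _ _ (conf w (upd s r (s r).+1) 0 o)).
  by apply: runs_inc => //; lia.
apply: runs_ext (IH (upd s r (s r).+1) _) _ _ => //.
  by move=> j jd; rewrite /upd gtn_eqF ?s0 //; apply: leq_trans jd.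
by apply: conf_ext; upd_tac.
Qed.

Lemma comp_len V : comp_correct V Len (fun n => n * 20 + 1).
Proof.
move=> d r w s o B /andP[Vr rd] /=; rewrite addn1 => dR s0 [wB _].
have rR : r < R by lia.
have sd := s0 d (leqnn d).
apply: (@runs_leq _ _ _ (size w * 5 + size w * 7).+1); first by lia.
apply: (@runs_seq _ _ _ _ _ _ _ (conf w (upd s d (size w)) (size w) o)).
  have := @runs_loop S _ (insym isSome) (fseq fnext (finc d)) 3 (size w)
    (fun i => conf w (upd s d i) i o).
  move=> H; apply: runs_ext (H _ _) _ _ => //.
  - move=> i ik; split; first by rewrite insymE onthTE.
    apply: (@runs_seq _ _ _ _ 1 1 _ (conf w (upd s d i) i.+1 o)); first exact: runs_next.
    by apply: runs_inc => //; upd_tac.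
  - by rewrite insymE onth_default.
  - by apply: conf_ext; upd_tac.
have := @runs_floop d (fseq fprev (finc r)) 3 w (fun i => upd s r (s r + i))
  (fun i => size w - i) (fun=> o) (size w) dR.
rewrite subnn; move=> H; apply: runs_ext (H _) _ _ => //.
- move=> i ik.
  have -> : size w - i = (size w - i.+1).+1 by lia.
  apply: (@runs_seq _ _ _ _ 1 1 _
    (conf w (upd (upd s r (s r + i)) d (size w - i.+1)) (size w - i.+1) o)).
    exact: runs_prev.
  by apply: runs_inc => //; upd_tac.
- by rewrite subn0; apply: conf_ext; upd_tac.
- by apply: conf_ext; upd_tac.
Qed.

Lemma upd_zero (s : nat -> nat) d d' x v : d <= d' -> x < d' ->
  (forall j, d <= j -> s j = 0) -> forall j, d' <= j -> upd s x v j = 0.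
Proof. by move=> dd xd s0 j dj; rewrite /upd gtn_eqF ?s0 //; lia. Qed.

Lemma bounded_scratch V B w s x v :
  V <= x -> bounded V B w s -> bounded V B w (upd s x v).
Proof.
by move=> Vx [lw ls]; split=> // j jV; rewrite /upd ltn_eqF ?ls // (leq_trans jV).
Qed.

Lemma eval_scratch V w e s x v :
  nvars e <= V -> V <= x -> eval w e (upd s x v) = eval w e s.
Proof.
move=> eV Vx; apply: (@eval_eq _ _ _ V) => // j jV.
by rewrite /upd ltn_eqF // (leq_trans jV).
Qed.

Lemma comp_add V a b f g : nvars b <= V ->
  comp_correct V a f -> comp_correct V b g ->
  comp_correct V (Add a b) (fun n => f n + g n + 1).
Proof.
move=> bV Ha Hb d r w s o B Vrd dR s0 bnd; rewrite addn1.
have [Vr rd] := andP Vrd; move: dR => /= dR.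
apply: runs_seq (Ha _ _ _ _ o _ Vrd _ s0 bnd) _; first by lia.
apply: runs_ext (Hb d r w (upd s r (s r + eval w a s)) o B Vrd _ _ _) _ _ => //; first by lia.
- by apply: (upd_zero _ _ _ s0); lia.
- exact: bounded_scratch.
- by rewrite (eval_scratch _ _ _ bV) //; apply: conf_ext; upd_tac.
Qed.

Lemma comp_sub V a b f g fa fb : nvars a <= V -> nvars b <= V ->
  comp_correct V a f -> comp_correct V b g ->
  (forall w s B, bounded V B w s -> eval w a s <= fa B) ->
  (forall w s B, bounded V B w s -> eval w b s <= fb B) ->
  comp_correct V (Monus a b) (fun n => f n + g n + fa n * 10 + fb n * 10 + 10).
Proof.
move=> aV bV Ha Hb ba bb d r w s o B /andP[Vr rd] /= dR s0 bnd.
have := ba _ _ _ bnd; have := bb _ _ _ bnd.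
set va := eval w a s; set vb := eval w b s => lb la.
have [dr dr1] : d < R /\ d.+1 < R by lia.
have sd := s0 d (leqnn d); have sd1 := s0 d.+1 (leqnSn d).
apply: (@runs_leq _ _ _ (f B + (g B + (vb * 5 + (va - vb) * 5).+1).+1).+1); first by lia.
apply: (@runs_seq _ _ _ _ _ _ _ (conf w (upd s d va) 0 o)).
  apply: runs_ext (Ha d.+1 d w s o B _ _ _ bnd) _ _ => //; try lia.
    by move=> j jd; apply: s0; lia.
  by rewrite sd.
apply: (@runs_seq _ _ _ _ _ _ _ (conf w (upd (upd s d va) d.+1 vb) 0 o)).
  apply: runs_ext (Hb d.+2 d.+1 w (upd s d va) o B _ _ _ _) _ _ => //; try lia.
  - by apply: (upd_zero _ _ _ s0); lia.
  - by apply: bounded_scratch => //; lia.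
  - rewrite (eval_scratch _ _ _ bV) //; last by lia.
    by apply: conf_ext; upd_tac.
apply: (@runs_seq _ _ _ _ _ _ _ (conf w (upd s d (va - vb)) 0 o)).
  have := @runs_floop d.+1 (fdec d) 1 w (fun i => upd s d (va - i)) (fun=> 0) (fun=> o) vb dr1.
  move=> H; apply: runs_ext (H _) _ _ => //.
  - by move=> i ik; apply: runs_dec => //; upd_tac.
  - by apply: conf_ext; upd_tac.
  - by apply: conf_ext; upd_tac.
rewrite [X in X * 5](_ : _ = upd s d (va - vb) d); last by rewrite /upd eqxx.
by apply: runs_fadd => //; [lia|lia|upd_tac].
Qed.

Lemma comp_mul V a b f g fa : nvars a <= V -> nvars b <= V ->
  comp_correct V a f -> comp_correct V b g ->
  (forall w s B, bounded V B w s -> eval w a s <= fa B) ->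
  comp_correct V (Mul a b) (fun n => f n + fa n * (g n + 4) + 1).
Proof.
move=> aV bV Ha Hb ba d r w s o B /andP[Vr rd] /= dR s0 bnd.
have := ba _ _ _ bnd; set va := eval w a s; set vb := eval w b s => la.
have dr : d < R by lia.
have sd := s0 d (leqnn d).
apply: (@runs_leq _ _ _ (f B + va * (g B).+4).+1).
  by rewrite addn4 addn1 ltnS leq_add2l leq_mul2r la orbT.
apply: (@runs_seq _ _ _ _ _ _ _ (conf w (upd s d va) 0 o)).
  apply: runs_ext (Ha d.+1 d w s o B _ _ _ bnd) _ _ => //; try lia.
    by move=> j jd; apply: s0; lia.
  by rewrite sd.
(* The value of [b] is the same in every pass, because only registers above its variables change. *)
have := @runs_floop d (compile d.+1 r b) (g B) w (fun i => upd s r (s r + i * vb))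
  (fun=> 0) (fun=> o) va dr.
move=> H; apply: runs_ext (H _) _ _ => //; last first.
- by apply: conf_ext; upd_tac.
- by apply: conf_ext; upd_tac.
move=> i ik.
pose s' := upd (upd s r (s r + i * vb)) d (va - i.+1).
apply: runs_ext (Hb d.+1 r w s' o B _ _ _ _) _ _ => //; try lia.
- move=> j jd; rewrite /s' /upd; do !(case: eqP => ?; first lia); apply: s0; lia.
- by do 2!(apply: bounded_scratch; first lia).
- rewrite /s' !(eval_scratch _ _ _ bV) //; try lia.
  by apply: conf_ext; upd_tac; rewrite mulSn; lia.
Qed.

Lemma comp_sum V x a b f g fa : x < V -> nvars a <= V -> nvars b <= V ->
  comp_correct V a f -> comp_correct V b g ->
  (forall w s B, bounded V B w s -> eval w a s <= fa B) ->
  comp_correct V (Sum x a b) (fun n => f n + n * 10 + fa n * (g (n + fa n) + 10) + 4).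
Proof.
move=> xV aV bV Ha Hb ba d r w s o B /andP[Vr rd] /= dR s0 bnd.
have := ba _ _ _ bnd; set va := eval w a s => la.
have sd := s0 d (leqnn d); have sd1 := s0 d.+1 (leqnSn d).
have sx : s x <= B by case: bnd => _; apply.
apply: (@runs_leq _ _ _ (f B + s x * 10 + va * (g (B + fa B) + 10) + 4)).
  by rewrite leq_add2r; apply: leq_add; [lia|rewrite leq_mul2r la orbT].
have := @runs_ffor d x (compile d.+1 d a) (compile d.+2 r b) (f B) (g (B + fa B)) w s
  (fun i => upd s r (s r + \sum_(j < i) eval w b (upd s x j))) (fun=> o) va.
move=> H; apply: runs_ext (H _ _ _ _ _ _ _) _ _ => //; try lia.
- by rewrite big_ord0; upd_tac.
- apply: runs_ext (Ha d.+1 d w s o B _ _ _ bnd) _ _ => //; try lia.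
    by move=> j jd; apply: s0; lia.
  by rewrite sd.
- move=> i ik; set st := upd _ x i.
  apply: runs_ext (Hb d.+2 r w st o (B + fa B) _ _ _ _) _ _ => //; try lia.
  + by move=> j jd; rewrite /st /upd; do !(case: eqP => ?; first lia); apply: s0; lia.
  + apply: bounded_upd; first lia.
    do 3!(apply: bounded_scratch; first lia).
    by apply: bounded_leq bnd; lia.
  (* The accumulator, the counter and the saved value of [x] all lie at or above [V], so the body
     does not see them. *)
  + rewrite (_ : eval w b st = eval w b (upd s x i)); last first.
      apply: (@eval_eq _ _ _ V) => // j jV; rewrite /st /upd; case: eqP => // _.
      by rewrite !ltn_eqF //; lia.
    by rewrite big_ord_recr /=; apply: conf_ext; rewrite /st; upd_tac; rewrite addnA.
- by apply: conf_ext; upd_tac.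
Qed.

Lemma comp_sym V P a f fa : nvars a <= V -> comp_correct V a f ->
  (forall w s B, bounded V B w s -> eval w a s <= fa B) ->
  comp_correct V (Sym P a) (fun n => f n + fa n * 20 + 10).
Proof.
move=> aV Ha ba d r w s o B /andP[Vr rd] /= dR s0 bnd.
have := ba _ _ _ bnd; set va := eval w a s => la.
have sd := s0 d (leqnn d); have sd1 := s0 d.+1 (leqnSn d).
have [dr dr1] : d < R /\ d.+1 < R by lia.
pose v := s r + P (onth w va).
apply: (@runs_leq _ _ _ (f B + (va * 7 + (2 + va * 5).+1).+1).+1); first by lia.
apply: (@runs_seq _ _ _ _ _ _ _ (conf w (upd s d va) 0 o)).
  apply: runs_ext (Ha d.+1 d w s o B _ _ _ bnd) _ _ => //; try lia.
    by move=> j jd; apply: s0; lia.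
  by rewrite sd.
apply: (@runs_seq _ _ _ _ _ _ _ (conf w (upd s d.+1 va) va o)).
  have := @runs_floop d (fseq fnext (finc d.+1)) 3 w (fun i => upd s d.+1 i) id (fun=> o) va dr.
  move=> H; apply: runs_ext (H _) _ _ => //.
  - move=> i ik; apply: (@runs_seq _ _ _ _ 1 1 _
      (conf w (upd (upd s d.+1 i) d (va - i.+1)) i.+1 o)).
      exact: runs_next.
    by apply: runs_inc => //; upd_tac.
  - by apply: conf_ext; upd_tac.
  - by apply: conf_ext; upd_tac.
apply: (@runs_seq _ _ _ _ _ _ _ (conf w (upd (upd s r v) d.+1 va) va o)).
  apply: runs_if; rewrite insymE /v; case: (P _).
    by apply: runs_inc; [lia|upd_tac].
  apply: (@runs_leq _ _ _ 0) => //.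
  by apply: runs_ext (@runs_skip _ _ _) _ _ => //; apply: conf_ext; upd_tac.
have := @runs_floop d.+1 fprev 1 w (fun i => upd s r v) (fun i => va - i) (fun=> o) va dr1.
rewrite subnn subn0; move=> H; apply: runs_ext (H _) _ _ => //.
- move=> i ik; have -> : va - i = (va - i.+1).+1 by lia.
  exact: runs_prev.
- by apply: conf_ext; upd_tac.
Qed.

Lemma compileP V e : nvars e <= V -> exists f, poly_bounded f /\ comp_correct V e f.
Proof.
elim: e => [x|n||a IHa b IHb|a IHa b IHb|a IHa b IHb|x a IHa b IHb|P a IHa] /=;
  rewrite ?geq_max.
- move=> xV; eexists; split; last exact: comp_var.
  by poly_tac.
- by move=> _; eexists; split; last exact: comp_cst; exact: poly_bounded_cst.
- move=> _; eexists; split; last exact: comp_len.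
  by poly_tac.
- move=> /andP[aV bV]; have [f [pf Hf]] := IHa aV; have [g [pg Hg]] := IHb bV.
  eexists; split; last exact: comp_add Hf Hg.
  by poly_tac.
- move=> /andP[aV bV]; have [f [pf Hf]] := IHa aV; have [g [pg Hg]] := IHb bV.
  have [fa [pa Ba]] := eval_bound aV; have [fb [pb Bb]] := eval_bound bV.
  eexists; split; last exact: comp_sub Hf Hg Ba Bb.
  by poly_tac.
- move=> /andP[aV bV]; have [f [pf Hf]] := IHa aV; have [g [pg Hg]] := IHb bV.
  have [fa [pa Ba]] := eval_bound aV.
  eexists; split; last exact: comp_mul Hf Hg Ba.
  by poly_tac.
- move=> /and3P[xV aV bV]; have [f [pf Hf]] := IHa aV; have [g [pg Hg]] := IHb bV.
  have [fa [pa Ba]] := eval_bound aV.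
  eexists; split; last exact: comp_sum Hf Hg Ba.
  by poly_tac; apply: (@poly_bounded_comp g) => //; poly_tac.
- move=> aV; have [f [pf Hf]] := IHa aV; have [fa [pa Ba]] := eval_bound aV.
  eexists; split; last exact: comp_sym Hf Ba.
  by poly_tac.
Qed.


End Registers.

(** * Programs that print words by bounded loops *)

Section Generator.

Inductive gen :=
  | GNil
  | GEmit of expr bool
  | GCat of gen & gen
  | GFor of nat & expr bool & gen.

Fixpoint gout (w : seq bool) (g : gen) (s : nat -> nat) : seq bool :=
  match g with
  | GNil => [::]
  | GEmit e => [:: eval w e s != 0]
  | GCat g h => gout w g s ++ gout w h s
  | GFor x a g => flatten [seq gout w g (upd s x i) | i <- iota 0 (eval w a s)]
  end.

Fixpoint gvars (g : gen) : nat :=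
  match g with
  | GNil => 0
  | GEmit e => nvars e
  | GCat g h => maxn (gvars g) (gvars h)
  | GFor x a g => maxn x.+1 (maxn (nvars a) (gvars g))
  end.

Fixpoint gscratch (g : gen) : nat :=
  match g with
  | GNil => 0
  | GEmit e => (scratch e).+1
  | GCat g h => maxn (gscratch g) (gscratch h)
  | GFor x a g => maxn (scratch a).+1 (gscratch g).+2
  end.

Variable R : nat.

Fixpoint gcompile d (g : gen) : frag bool R.+1 :=
  match g with
  | GNil => @fskip bool R.+1
  | GEmit e => fseq (compile R d.+1 d e)
      (fseq (fif (nonzero d) (fout R true) (fout R false)) (fclear bool R d))
  | GCat g h => fseq (gcompile d g) (gcompile d h)
  | GFor x a g => ffor d x (compile R d.+1 d a) (gcompile d.+2 g)
  end.

Lemma gout_eq w g V s s' : gvars g <= V -> (forall j, j < V -> s j = s' j) ->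
  gout w g s = gout w g s'.
Proof.
elim: g s s' => [|e|g IHg h IHh|x a g IHg] s s' //=; rewrite ?geq_max.
- by move=> eV E; rewrite (eval_eq w eV E).
- by move=> /andP[gV hV] E; rewrite (IHg s s') // (IHh s s').
- move=> /and3P[xV aV gV] E; rewrite (eval_eq w aV E).
  congr flatten; apply: eq_map => i; apply: IHg => // j jV.
  by rewrite /upd E.
Qed.

Definition gcomp_correct V g f :=
  forall d w s o B, V <= d -> d + gscratch g <= R ->
    (forall j, d <= j -> s j = 0) -> bounded V B w s ->
    runs (gcompile d g) (f B) (conf w s 0 o) (conf w s 0 (o ++ gout w g s)).

Lemma gcompileP V g : gvars g <= V -> exists f, poly_bounded f /\ gcomp_correct V g f.
Proof.
elim: g => [|e|g IHg h IHh|x a g IHg] /=; rewrite ?geq_max.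
- move=> _; exists (fun=> 0); split; first exact: poly_bounded_cst.
  by move=> d w s o B _ _ _ _; rewrite cats0; apply: runs_skip.
- move=> eV; have [f [pf Hf]] := compileP R eV; have [fe [pe Be]] := eval_bound eV.
  exists (fun n => f n + fe n * 4 + 10); split; first by poly_tac.
  move=> d w s o B Vd /= dR s0 bnd.
  have := Be _ _ _ bnd; set v := eval w e s => lv.
  have dR0 : d < R by lia.
  have dR1 : d.+1 + scratch e <= R by rewrite addSnnS.
  have sd := s0 d (leqnn d).
  apply: (@runs_leq _ _ _ (f B + (2 + v * 4).+1).+1); first by lia.
  apply: (@runs_seq _ _ _ _ _ _ _ (conf w (upd s d v) 0 o)).
    apply: runs_ext (Hf d.+1 d w s o B _ _ _ bnd) _ _ => //; try lia.
      by move=> j jd; apply: s0; lia.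
    by rewrite sd.
  apply: (@runs_seq _ _ _ _ _ _ _ (conf w (upd s d v) 0 (o ++ [:: v != 0]))).
    apply: runs_if; rewrite nonzeroE // {1}/upd eqxx cats1.
    by case: (v != 0); apply: runs_out.
  rewrite [X in X * 4](_ : _ = upd s d v d); last by rewrite /upd eqxx.
  by apply: runs_fclear => //; upd_tac.
- move=> /andP[gV hV]; have [f [pf Hf]] := IHg gV; have [f' [pf' Hf']] := IHh hV.
  exists (fun n => f n + f' n + 1); split; first by poly_tac.
  move=> d w s o B Vd /= dR s0 bnd; rewrite addn1 catA.
  by apply: runs_seq (Hf _ _ _ _ _ _ _ _ bnd) (Hf' _ _ _ _ _ _ _ _ bnd) => //; lia.
- move=> /and3P[xV aV gV]; have [f [pf Hf]] := compileP R aV; have [h [ph Hh]] := IHg gV.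
  have [fa [pa Ba]] := eval_bound aV.
  exists (fun n => f n + n * 10 + fa n * (h (n + fa n) + 10) + 4); split.
    by poly_tac; apply: (@poly_bounded_comp h) => //; poly_tac.
  move=> d w s o B Vd /= dR s0 bnd.
  have := Ba _ _ _ bnd; set va := eval w a s => la.
  have sd := s0 d (leqnn d); have sd1 := s0 d.+1 (leqnSn d).
  have sx : s x <= B by case: bnd => _; apply.
  have dR1 : d.+1 + scratch a <= R by apply: leq_trans dR; rewrite addSnnS leq_add2l leq_max leqnn.
  apply: (@runs_leq _ _ _ (f B + s x * 10 + va * (h (B + fa B) + 10) + 4)).
    by rewrite leq_add2r; apply: leq_add; [lia|rewrite leq_mul2r la orbT].
  (* The output tape after [i] passes. *)
  pose oi i := o ++ flatten [seq gout w g (upd s x j) | j <- iota 0 i].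
  have o0 : oi 0 = o by rewrite /oi cats0.
  have := @runs_ffor _ R d x (compile R d.+1 d a) (gcompile d.+2 g) (f B) (h (B + fa B)) w s
    (fun=> s) oi va.
  rewrite o0 => H; apply: runs_ext (H _ _ _ _ _ _ _) _ _ => //; try lia.
  + apply: runs_ext (Hf d.+1 d w s o B _ _ _ bnd) _ _ => //; try lia.
      by move=> j jd; apply: s0; lia.
    by rewrite sd.
  + move=> i ik; set st := upd _ x i.
    have -> : oi i.+1 = oi i ++ gout w g (upd s x i).
      by rewrite /oi -[i.+1]addn1 iotaD map_cat flatten_cat /= cats0 catA.
    rewrite -(_ : gout w g st = gout w g (upd s x i)); last first.
      apply: (@gout_eq _ _ V) => // j jV; rewrite /st /upd; case: eqP => // _.
      by rewrite !ltn_eqF //; lia.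
    apply: Hh; try lia.
    * by move=> j jd; rewrite /st /upd; do !(case: eqP => ?; first lia); apply: s0; lia.
    * apply: bounded_upd; first lia.
      do 2!(apply: bounded_scratch; first lia).
      by apply: bounded_leq bnd; lia.
  + by clear H o0; apply: conf_ext; upd_tac.
Qed.

End Generator.

(** * From fragments to polynomial time *)

Lemma step_halting (S : finType) (M : tm S) (c : config M) n :
  halting c.1 -> iter n (@step S M) c = c.
Proof. by move=> h; elim: n => //= n ->; rewrite /step h. Qed.

Lemma run_halting (S : finType) (M : tm S) m n w :
  m <= n -> halting (run M m w).1 -> run M n w = run M m w.
Proof. by move=> /subnK <- h; rewrite /run iterD step_halting. Qed.

Lemma view_perform (S : finType) K (a : {ffun 'I_K.+1 -> option (S + unit) * move}) t i z :
  view (perform a t i) z =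
  if (z + offset (a i).2 == 0)%R then (a i).1 else view (t i) (z + offset (a i).2)%R.
Proof. by rewrite ffunE view_shift view_write. Qed.

Section Machine.
Variables (S : finType) (K : nat) (F : frag S K).
Variable acc : pred {ffun 'I_K.+1 -> option (S + unit)}.

(** The exit of the fragment becomes one more step into a halting state [inr b], whose verdict [b]
    is read off the symbols scanned at that moment. *)
Definition machine : tm S :=
  @TM S K unit (fstate F + bool)%type (inl (fstart F))
    (fun q => if q is inr _ then true else false)
    (fun q => if q is inr b then b else false)
    (fun q s => match q with
       | inl q => if fdelta q s is Some (q', a) then (inl q', a)
                  else (inr (acc s), keep s)
       | inr b => (inr b, keep s)
       end).

Lemma run_machine w n t : exits F n (init machine w).2 t ->
  run machine n.+1 w = (inr (acc (scan t)), perform (keep (scan t)) t).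
Proof.
move=> [q [e x]].
(* It suffices to find the time [m] of the actual exit; the machine halts one step later and then
   stays put. *)
suff [m mn E] : exists2 m, m <= n & iter m (@step S machine) (init machine w) = (inl q, t).
  have R : run machine m.+1 w = (inr (acc (scan t)), perform (keep (scan t)) t).
    rewrite /run iterS E /step /=.
    rewrite -[finfun (fun i => scanned (t i))]/(scan t) x.
    by congr pair.
  by rewrite -R; apply: run_halting; rewrite ?R.
rewrite /init /= in e *; move: (fstart F) e; set t0 := finfun _.
elim: n t0 => [|n IH] t0 q0 e; first by exists 0 => //; case: e => -> ->.
move: e; rewrite iterSr {2}/fstep /=; case D: (fdelta q0 (scan t0)) => [[q1 a]|].
  move=> /IH [m mn e]; exists m.+1 => //.
  rewrite iterSr -e; congr (iter m _ _); rewrite /step /=.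
  by rewrite -[finfun (fun i => scanned (t0 i))]/(scan t0) D.
by rewrite fstep_exit // => -[<- <-]; exists 0.
Qed.

End Machine.

Section Start.
Variables (S : finType) (R : nat).

(** Register tapes are blank at first; marking their origins sets all counters to 0. *)
Definition fstart_marks : frag S R.+1 :=
  fact (fun s => [ffun i => if (i == ord0) || (i == ord_max) then (s i, Stay)
                            else (mark S, Stay)]).

Lemma word_at_nil z : @word_at S [::] z = None.
Proof. by case: z => // n; rewrite /= nth_nil. Qed.

Lemma view_init (M : tm S) (w : seq S) i z :
  view ((init M w).2 i) z =
  if i == ord0 then if z is Posz n then nth None (written M w) n else None else None.
Proof. by rewrite ffunE; case: eqP => _; case: z => n //=; rewrite nth_nil. Qed.

Lemma exits_start (F : frag S R.+1) acc w :
  exists2 t, exits fstart_marks 1 (init (@machine S R.+1 F acc) w).2 t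
           & shows (conf w (fun=> 0) 0 [::]) t.
Proof.
eexists; first exact: exits_act.
have := view_init (M := machine F acc) w; rewrite /written /=.
move: (finfun _) => t0 v0 i z; rewrite view_perform !ffunE !scanned_view !v0.
have [i0|ni0] := eqVneq i ord0.
  rewrite i0 /conf /= !addr0.
  by case: eqP => [->|_] //; rewrite /written /word_at /out_tape; case: z.
have [im|nim] := eqVneq i ord_max.
  rewrite im in ni0 *; rewrite /conf (negbTE ni0) eqxx /= word_at_nil.
  by case: ifP.
rewrite /conf (negbTE ni0) (negbTE nim) /= !addr0.
by case: eqP => [->//|]; case: z => [[|n]|n] //=; rewrite nth_nil.
Qed.

End Start.

Lemma expr_in_P (S : finType) (e : expr S) :
  in_P (fun w => eval w e (fun=> 0) != 0).
Proof.
(* Registers below [V] belong to the variables, register [V] receives the value, and scratch starts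
   at [V.+1]. *)
pose V := nvars e; pose R := V.+1 + scratch e + 1.
have [f [pf Hf]] := compileP R (leqnn V).
have [p Hp] : exists p : {poly nat}, forall n, f n + 3 <= horner p n.
  apply: poly_bounded_horner; poly_tac.
pose F := fseq (@fstart_marks S R) (compile R V.+1 V e).
exists (machine F (nonzero V)), p => w.
have [t1 x1 sh1] := @exits_start S R F (nonzero V) w.
have [t2 x2 sh2] : exists2 t2,
    exits (compile R V.+1 V e) (f (size w)) (perform (keep (scan t1)) t1) t2
    & shows (conf w (upd (fun=> 0) V (eval w e (fun=> 0))) 0 [::]) t2.
  by apply: (Hf V.+1 V w (fun=> 0) [::] (size w)) (perform_keep sh1) => //; lia.
have x := run_machine (exits_trans_seq x1 x2).
rewrite (@run_halting _ _ (1 + f (size w)).+2); last 2 first.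
- by apply: leq_trans (Hp _); lia.
- by rewrite x.
rewrite x (scan_shows sh2) /= nonzeroE; last by rewrite /R; lia.
by rewrite /upd eqxx.
Qed.

Section Rewind.
Variables (S : finType) (R : nat).

(** [holds_word] wants the head on the first letter, but printing leaves it past the last one.
    Printed letters are never blank, so the first blank met on the left marks the beginning. *)
Definition frewind : frag S R.+1 :=
  fseq (fmove S ord_max MoveLeft)
    (fseq (fwhile (fun s => s ord_max != None) (fmove S ord_max MoveLeft))
          (fmove S ord_max MoveRight)).

Lemma conf_out w s p o : @conf S R w s p o ord_max = (out_tape o, Posz (size o)).
Proof. by rewrite /conf eqxx -(inj_eq val_inj). Qed.

Lemma runs_rewind w s o :
  runs frewind (size o * 3 + 4) (conf w s 0 o)
    (set_tape (conf w s 0 o) ord_max (out_tape o, Posz 0)).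
Proof.
(* The output head after [i.+1] moves to the left; at [i = size o] it stands on the blank at
   position -1. *)
pose T (i : nat) : content S R.+1 :=
  set_tape (conf w s 0 o) ord_max (out_tape o, (Posz (size o) - Posz i.+1)%R).
have Tm i : T i ord_max = (out_tape o, (Posz (size o) - Posz i.+1)%R).
  by rewrite /T /set_tape eqxx.
have mv m (U : content S R.+1) z z' : (U ord_max).1 = out_tape o -> (U ord_max).2 = z' ->
    (z' + offset m)%R = z ->
    runs (fmove S ord_max m) 1 U (set_tape U ord_max (out_tape o, z)).
  by move=> e <- <-; apply: runs_ext (@runs_move _ _ ord_max m U) _ _ => // i; rewrite /set_tape e.
have TT (U : content S R.+1) c c' :
    set_tape (set_tape U ord_max c) ord_max c' =1 set_tape U ord_max c'.
  by move=> i; rewrite /set_tape; case: eqP.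
apply: (@runs_leq _ _ _ (1 + (size o * 3 + 1).+1).+1); first lia.
apply: (@runs_seq _ _ _ _ _ _ _ (T 0)).
  by apply: (@mv MoveLeft _ _ (Posz (size o))); rewrite ?conf_out.
apply: (@runs_seq _ _ _ _ _ _ _ (T (size o))).
  apply: runs_loop => [i il|].
    split.
      rewrite ffunE Tm /=.
      have -> : (Posz (size o) - Posz i.+1)%R = Posz (size o - i.+1) by lia.
      rewrite /= nth_out_tape; have := onthTE o (size o - i.+1).
      by rewrite (_ : (_ < _) = true); [case: onth|lia].
    apply: runs_ext (@mv MoveLeft (T i) _ _ _ erefl erefl) _ _ => //; rewrite ?Tm //.
    move=> j; rewrite TT /T /= /set_tape; case: eqP => // _; congr pair; lia.
  rewrite ffunE Tm /=.
  by have -> : (Posz (size o) - Posz (size o).+1)%R = Negz 0 by lia.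
apply: runs_ext (@mv MoveRight (T (size o)) (Posz 0) _ _ erefl _) _ _ => //;
  rewrite ?Tm //=; last exact: TT.
by lia.
Qed.

End Rewind.

Lemma gout_bound V g : gvars g <= V ->
  exists f, poly_bounded f /\ forall w s B, bounded V B w s -> size (gout w g s) <= f B.
Proof.
elim: g => [|e|g IHg h IHh|x a g IHg] /=; rewrite ?geq_max.
- by move=> _; exists (fun=> 0); split; first exact: poly_bounded_cst.
- by move=> _; exists (fun=> 1); split; first exact: poly_bounded_cst.
- move=> /andP[gV hV]; have [f [pf Hf]] := IHg gV; have [f' [pf' Hf']] := IHh hV.
  exists (fun n => f n + f' n); split; first by poly_tac.
  by move=> w s B bnd; rewrite size_cat leq_add ?Hf ?Hf'.
- move=> /and3P[xV aV gV]; have [f [pf Hf]] := IHg gV.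
  have [fa [pa Ba]] := eval_bound aV.
  exists (fun n => fa n * f (n + fa n)); split.
    by poly_tac; apply: (@poly_bounded_comp f) => //; poly_tac.
  move=> w s B bnd; have la := Ba _ _ _ bnd.
  apply: (@leq_trans (eval w a s * f (B + fa B))); last by rewrite leq_mul2r la orbT.
  have : forall i, i \in iota 0 (eval w a s) ->
      size (gout w g (upd s x i)) <= f (B + fa B).
    move=> i; rewrite mem_iota => /andP[_ il]; apply: Hf.
    by apply: bounded_upd; [lia|apply: bounded_leq bnd; lia].
  rewrite -[X in _ -> _ <= X * _](size_iota 0 (eval w a s)).
  elim: (iota _ _) => //= i l IH H; rewrite size_cat mulSn leq_add ?H ?mem_head //.
  by apply: IH => j jl; apply: H; rewrite inE jl orbT.
Qed.

Lemma gen_poly_time (g : gen) : poly_time (fun w => gout w g (fun=> 0)).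
Proof.
pose V := gvars g; pose R := V + gscratch g + 1.
have [f [pf Hf]] := gcompileP R (leqnn V).
have [h [ph Hh]] := gout_bound (leqnn V).
have [p Hp] : exists p : {poly nat}, forall n, f n + h n * 3 + 10 <= horner p n.
  by apply: poly_bounded_horner; poly_tac.
pose G := fseq (gcompile R V g) (frewind bool R).
pose F := fseq (fstart_marks bool R) G.
exists (machine F xpred0), p => w.
set out := gout w g _.
have bnd : bounded V (size w) w (fun=> 0) by [].
have r1 : runs (gcompile R V g) (f (size w)) (conf w (fun=> 0) 0 [::])
    (conf w (fun=> 0) 0 ([::] ++ out)) by apply: Hf => //; lia.
have rG : runs G _ _ _ := runs_seq r1 (@runs_rewind _ R w (fun=> 0) out).
have [t1 x1 sh1] := exits_start F xpred0 w.
have [t2 x2 sh2] := rG _ (perform_keep sh1).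
have x := run_machine (exits_trans_seq x1 x2).
rewrite (@run_halting _ _ (1 + (f (size w) + (size out * 3 + 4)).+1).+2); last 2 first.
- by apply: leq_trans (Hp _); have := Hh _ _ _ bnd; rewrite -/out /=; lia.
- by rewrite x.
rewrite x; split=> // i; have := perform_keep sh2 ord_max (Posz i).
rewrite /set_tape eqxx addr0 /= => ->.
by rewrite /written nth_out_tape -onth_map onthE -map_comp.
Qed.

(** * Membership in NP *)

Section LazyWalk.
Variable G : sgraph.

Definition near (x y : G) := (x == y) || adj x y.

(** Pausing makes exactly [m] steps express distance at most [m], and the recursion is the one of
    [walk_expr]. *)
Fixpoint lazy_walk m (x y : G) : Prop :=
  if m is m'.+1 then exists2 a, near x a & lazy_walk m' a y else x = y.

Lemma near_sym x y : near x y = near y x.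
Proof. by rewrite /near eq_sym adj_sym. Qed.

Lemma lazy_walkD m n x y z : lazy_walk m x y -> lazy_walk n y z -> lazy_walk (m + n) x z.
Proof.
elim: m x => [|m IH] x /=; first by move=> ->.
by move=> [a xa /IH h /h]; exists a.
Qed.

Lemma lazy_walk_sym m x y : lazy_walk m x y -> lazy_walk m y x.
Proof.
elim: m x => [|m IH] x /=; first by move=> ->.
move=> [a xa /IH h].
have ax : lazy_walk 1 a x by exists x; rewrite // near_sym.
by have := lazy_walkD h ax; rewrite addn1.
Qed.

Lemma lazy_walk_path m x y :
  lazy_walk m x y <-> exists p, [/\ size p <= m, path (@adj G) x p & last x p = y].
Proof.
elim: m x => [|m IH] x /=.
  by split=> [<-|[[|a p] []]] //; exists [::].
split=> [[a /orP[/eqP<-|xa] /IH[p [sp pp lp]]]|[[|a p] [/= sp pp lp]]].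
- by exists p; split=> //; apply: leqW.
- by exists (a :: p); split=> //=; rewrite xa.
- by exists x; [rewrite /near eqxx|apply/IH; exists [::]].
- case/andP: pp => xa pp; exists a; first by rewrite /near xa orbT.
  by apply/IH; exists p.
Qed.

Lemma lazy_walk_leq m n x y : m <= n -> lazy_walk m x y -> lazy_walk n x y.
Proof.
move=> mn /lazy_walk_path[p [sp pp lp]]; apply/lazy_walk_path.
by exists p; split=> //; apply: leq_trans mn.
Qed.

(** Connectedness excludes the default value of [dist], which could be at most [m] with no walk
    present. The search below [#|G|] succeeds because a walk can be shortened to a path without
    repeated vertices. *)
Lemma dist_leqP m x y : connect (@adj G) x y ->
  dist x y <= m <-> lazy_walk m x y.
Proof.
move=> /connectP[q pq lq].
pose P k := [exists p : k.-tuple G, path (@adj G) x p && (last x p == y)].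
have short p : path (@adj G) x p -> last x p = y ->
    exists2 k, k < #|G| & k <= size p /\ P k.
  case/shortenP=> p' pp' up' sub lp'; exists (size p').
    by rewrite -ltnS -[(size p').+1]/(size (x :: p')) -(card_uniqP up') ltnS max_card.
  split; first by apply: uniq_leq_size sub; case/andP: up'.
  by apply/existsP; exists (in_tuple p'); rewrite pp' lp' eqxx.
have [k0 k0G [_ Pk0]] := short q pq (esym lq).
have hP : has P (iota 0 #|G|) by apply/hasP; exists k0; rewrite // mem_iota.
split=> [dm|].
  have := nth_find 0 hP; rewrite nth_iota; last by rewrite -{2}(size_iota 0 #|G|) -has_find.
  case/existsP=> p /andP[pp /eqP lp]; apply/lazy_walk_path; exists p; split=> //.
  by rewrite size_tuple.
move=> /lazy_walk_path[p [sp pp lp]].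
have [k kG [kp Pk]] := short p pp lp.
apply: leq_trans sp; apply: leq_trans kp; rewrite leqNgt; apply/negP => lt.
by have := before_find 0 lt; rewrite nth_iota // add0n -/(P k) Pk.
Qed.

Lemma connected_diameterP m :
  connected G /\ diameter G <= m <-> 0 < #|G| /\ forall x y, lazy_walk m x y.
Proof.
split=> [[[G0 con] /bigmax_leqP dm]|[G0 lw]].
  split=> // x y; apply/(dist_leqP _ (con x y)).
  by have /bigmax_leqP := dm x isT; apply.
have con x y : connect (@adj G) x y.
  by have /lazy_walk_path[p [_ pp <-]] := lw x y; apply/connectP; exists p.
split=> //; apply/bigmax_leqP => x _; apply/bigmax_leqP => y _.
exact/(dist_leqP _ (con x y)).
Qed.

End LazyWalk.

(** * Expressions as formulas *)

Section Formula.
Variable S : Type.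
Implicit Types (a b e : expr S) (w : seq S) (s : nat -> nat).

(** With nonzero as true, [Mul], [Add] and [Sum] are conjunction, disjunction and bounded
    existential quantification. *)
Definition sat w e s := eval w e s != 0.

Definition Not e : expr S := Monus (Cst 1) e.
Definition Lt a b : expr S := Monus b a.
Definition Eq a b : expr S := Mul (Not (Monus a b)) (Not (Monus b a)).
Definition All x a e : expr S := Not (Sum x a (Not e)).

Lemma sat_not w e s : sat w (Not e) s = ~~ sat w e s.
Proof. by rewrite /sat /=; case: eval. Qed.

Lemma eval_eqn w a b s : eval w (Eq a b) s = (eval w a s == eval w b s).
Proof.
have E u v : 1 - (u - v) = (u <= v) :> nat by lia.
by rewrite /= !E eqn_leq; do 2!case: (_ <= _).
Qed.

Lemma sat_eqn w a b s : sat w (Eq a b) s = (eval w a s == eval w b s).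
Proof. by rewrite /sat eval_eqn; case: (eval w a s == _). Qed.

Lemma sat_lt w a b s : sat w (Lt a b) s = (eval w a s < eval w b s).
Proof. by rewrite /sat /= -lt0n subn_gt0. Qed.

Lemma sat_and w a b s : sat w (Mul a b) s = sat w a s && sat w b s.
Proof. by rewrite /sat /= muln_eq0 negb_or. Qed.

Lemma sat_or w a b s : sat w (Add a b) s = sat w a s || sat w b s.
Proof. by rewrite /sat /= addn_eq0 negb_and. Qed.

Lemma sat_sym w P a s : sat w (Sym P a) s = P (onth w (eval w a s)).
Proof. by rewrite /sat /=; case: (P _). Qed.

Definition Conj (l : seq (expr S)) : expr S := foldr (@Mul S) (Cst 1) l.
Lemma sat_conj w l s : sat w (Conj l) s = all (fun e => sat w e s) l.
Proof. by elim: l => //= e l <-; rewrite sat_and. Qed.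

Lemma sat_cst w (b : bool) s : sat w (Cst b) s = b.
Proof. by case: b. Qed.

Lemma sat_exists w x a e s :
  sat w (Sum x a e) s <-> exists2 i, i < eval w a s & sat w e (upd s x i).
Proof.
rewrite /sat /= sum_nat_eq0 negb_forall; split=> [/existsP[i] /= h|[i il h]].
  by exists (val i) => //; apply: ltn_ord.
by apply/existsP; exists (Ordinal il).
Qed.

Lemma sat_all w x a e s :
  sat w (All x a e) s <-> forall i, i < eval w a s -> sat w e (upd s x i).
Proof.
rewrite /All sat_not; split=> [/negP H i il|H].
  case h: (sat w e (upd s x i)) => //; case: H; apply/sat_exists.
  by exists i; rewrite ?sat_not ?h.
by apply/negP=> /sat_exists[i /H h]; rewrite sat_not h.
Qed.

End Formula.

(** * The verifier for narrow bipartite graphs *)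

Section Verifier.
Local Notation word := (seq (option bool)).
Local Notation N := (Var 0).

Definition one_at (a : expr (option bool)) := Sym (pred1 (Some (Some true))) a.
(** Variable 0 is the number n of vertices. The matrix starts at position n + 1, the separator is at
    n + 1 + n * n, and the certificate consists of two bit vectors of length n, one for the
    dominating set and one for a side of the bipartition. *)
Definition adj_expr a b := one_at (Add (Add N (Cst 1)) (Add (Mul a N) b)).
Definition near_expr a b := Add (Eq a b) (adj_expr a b).
Definition separator : expr (option bool) := Add (Add N (Cst 1)) (Mul N N).
Definition dom_expr a := one_at (Add (Add separator (Cst 1)) a).
Definition side_expr a := one_at (Add (Add separator (Cst 1)) (Add N a)).

Fixpoint walk_expr m x y z : expr (option bool) :=
  if m is m'.+1
  then Sum z N (Mul (near_expr (Var x) (Var z)) (walk_expr m' z y z.+1))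
  else Eq (Var x) (Var y).

Definition shape_expr : expr (option bool) :=
  Conj [::
    All 1 N (one_at (Var 1));
    Sym (pred1 (Some (Some false))) N;
    All 1 (Mul N N) (Sym (fun c => if c is Some (Some _) then true else false)
                         (Add (Add N (Cst 1)) (Var 1)));
    Sym (pred1 (Some None)) separator;
    All 1 N (Not (adj_expr (Var 1) (Var 1)));
    All 1 N (All 2 N (Eq (adj_expr (Var 1) (Var 2)) (adj_expr (Var 2) (Var 1))))].

Definition graph_expr : expr (option bool) :=
  Conj [::
    N;
    All 1 N (All 2 N (walk_expr 6 1 2 3));
    All 1 N (All 2 N (Add (Not (adj_expr (Var 1) (Var 2)))
                          (Not (Eq (side_expr (Var 1)) (side_expr (Var 2))))));
    All 1 N (Eq (Sum 2 N (Mul (near_expr (Var 1) (Var 2)) (dom_expr (Var 2)))) (Cst 1))].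

(** The number of vertices is guessed below the length of the word, and [shape_expr] confirms the
    guess. *)
Definition verifier := Sum 0 Len (Mul shape_expr graph_expr).

Lemma onth_pair_word (x y : seq bool) i :
  onth (pair_word x y) i =
    if i < size x then omap some (onth x i)
    else if i == size x then Some None else omap some (onth y (i - (size x).+1)).
Proof.
rewrite /pair_word onth_cat size_map !onth_map.
case: (ltngtP i (size x)) => [//|xi|->]; last by rewrite subnn.
have -> : i - size x = (i - (size x).+1).+1 by lia.
by rewrite /= onth_map.
Qed.

Lemma onth_allpairs (T U V : Type) (f : T -> U -> V) s t i j :
  j < size t -> onth (allpairs f s t) (i * size t + j) =
    if onth s i is Some x then omap (f x) (onth t j) else None.
Proof.
move=> jt; elim: s i => [|x s IH] i; first by rewrite !onth0n.
rewrite [allpairs _ _ _]/= onth_cat size_map; case: i => [|i].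
  by rewrite mul0n add0n jt onth_map.
by rewrite mulSn -addnA addKn ltnNge leq_addr /= IH.
Qed.

Lemma size_encode (G : sgraph) : size (encode_graph G) = #|G| + 1 + #|G| * #|G|.
Proof. by rewrite size_cat size_nseq /= size_allpairs -cardE addn1 addSnnS. Qed.

Lemma onth_enum_rank (T : finType) (x : T) : onth (enum T) (enum_rank x) = Some x.
Proof.
by rewrite onthE (nth_map x) ?nth_enum_rank // -cardE ltn_ord.
Qed.

Lemma onth_encode (G : sgraph) (x y : G) :
  onth (encode_graph G) (#|G| + 1 + (enum_rank x * #|G| + enum_rank y)) = Some (adj x y).
Proof.
rewrite /encode_graph onth_cat size_nseq -addnA ltnNge leq_addr /= addKn add1n /=.
by rewrite {2}cardE onth_allpairs -?cardE ?ltn_ord // !onth_enum_rank.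
Qed.

Section Encoded.
Variables (G : sgraph) (y : seq bool).
Let w := pair_word (encode_graph G) y.
Implicit Types (s : nat -> nat) (u v : G).

Definition marked k : {set G} := [set x | onth y (k + enum_rank x) == Some true].

Lemma sat_allG s x e : s 0 = #|G| ->
  sat w (All x N e) s <-> forall v, sat w e (upd s x (enum_rank v)).
Proof.
move=> s0; rewrite sat_all /= s0; split=> [H v|H i il]; first exact: H.
by have := H (enum_val (Ordinal il)); rewrite enum_valK.
Qed.

Lemma sat_existsG s x e : s 0 = #|G| ->
  sat w (Sum x N e) s <-> exists v, sat w e (upd s x (enum_rank v)).
Proof.
move=> s0; rewrite sat_exists /= s0; split=> [[i il H]|[v H]]; last by exists (enum_rank v).
by exists (enum_val (Ordinal il)); rewrite enum_valK.
Qed.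

Lemma eval_sumG s x e : s 0 = #|G| ->
  eval w (Sum x N e) s = \sum_(v : G) eval w e (upd s x (enum_rank v)).
Proof.
move=> s0; rewrite /= -(big_mkord xpredT (fun i => eval w e (upd s x i))) s0 big_mkord.
rewrite [RHS](big_enum_val (A := G)) /=.
by apply: eq_bigr => i _; rewrite enum_valK.
Qed.

Lemma eval_adj s a b u v : s 0 = #|G| ->
  eval w a s = enum_rank u -> eval w b s = enum_rank v ->
  eval w (adj_expr a b) s = adj u v.
Proof.
move=> s0 /= -> ->; rewrite s0 onth_pair_word onth_encode size_encode.
have [lu lv] := (ltn_ord (enum_rank u), ltn_ord (enum_rank v)).
rewrite ifT; first by case: (adj u v).
rewrite ltn_add2l; apply: (@leq_trans ((enum_rank u).+1 * #|G|)).
  by rewrite mulSn addnC ltn_add2r.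
by rewrite leq_mul2r lu orbT.
Qed.

(** A vertex is not adjacent to itself, so the two summands are never both 1. The value is thus 0 or
    1, which lets the domination test count by a sum. *)
Lemma eval_near s a b u v : s 0 = #|G| ->
  eval w a s = enum_rank u -> eval w b s = enum_rank v ->
  eval w (near_expr a b) s = near u v.
Proof.
move=> s0 ea eb; rewrite -[LHS]/(eval w (Eq a b) s + eval w (adj_expr a b) s).
rewrite (eval_adj s0 ea eb) eval_eqn ea eb /near.
rewrite (inj_eq val_inj) (inj_eq enum_rank_inj).
by case: eqP => // ->; rewrite adj_irrefl.
Qed.

(** Variables from [t] on are fresh, so binding [t] disturbs neither the endpoints nor the number of
    vertices. *)
Lemma sat_walk m x z t s u v : s 0 = #|G| -> 0 < t -> x < t -> z < t ->
  s x = enum_rank u -> s z = enum_rank v ->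
  sat w (walk_expr m x z t) s <-> lazy_walk m u v.
Proof.
elim: m x t s u => [|m IH] x t s u s0 t0 xt zt sx sz.
  rewrite [walk_expr _ _ _ _]/= sat_eqn /= sx sz (inj_eq val_inj) (inj_eq enum_rank_inj).
  by split=> /eqP.
rewrite [walk_expr _ _ _ _]/= sat_existsG //.
have E a : upd s t (enum_rank a) t = enum_rank a by rewrite /upd eqxx.
have F a j : j < t -> upd s t (enum_rank a) j = s j by move=> jt; rewrite /upd ltn_eqF.
split=> [[a]|[a ua av]].
  rewrite sat_and {1}/sat (@eval_near _ _ _ u a) /= ?E ?F //.
  case/andP=> na /IH h; exists a; first by move: na; case: near.
  by apply: h; rewrite ?E ?F //; lia.
exists a; rewrite sat_and {1}/sat (@eval_near _ _ _ u a) /= ?E ?F // ua /=.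
by case: (IH t t.+1 (upd s t (enum_rank a)) a) => [||||||_ h]; rewrite ?E ?F //; try lia; apply: h.
Qed.

Lemma eval_marked s p k v :
  eval w p s = #|G| + 1 + #|G| * #|G| + 1 + (k + enum_rank v) ->
  eval w (one_at p) s = (v \in marked k).
Proof.
move=> /= ->; rewrite onth_pair_word size_encode inE.
set m := #|G| + 1 + _; rewrite ltnNge -addnA leq_addr /=.
rewrite gtn_eqF; last by rewrite add1n addnS ltnS leq_addr.
have -> : m + (1 + (k + enum_rank v)) - m.+1 = k + enum_rank v by lia.
by case: (onth y _) => [[]|].
Qed.

Lemma sat_adj s a b u v : s 0 = #|G| ->
  eval w a s = enum_rank u -> eval w b s = enum_rank v ->
  sat w (adj_expr a b) s = adj u v.
Proof. by move=> s0 ea eb; rewrite /sat (eval_adj s0 ea eb); case: adj. Qed.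

Lemma sat_graph s : s 0 = #|G| ->
  sat w graph_expr s <->
  [/\ 0 < #|G|, forall u v : G, lazy_walk 6 u v,
      forall u v, adj u v -> (u \in marked #|G|) != (v \in marked #|G|)
    & efficient_dominating (marked 0)].
Proof.
move=> s0; rewrite sat_conj; set l := [:: _; _; _; _].
have -> : all (fun e => sat w e s) l <->
  [/\ sat w (nth N l 0) s, sat w (nth N l 1) s, sat w (nth N l 2) s & sat w (nth N l 3) s].
  by rewrite /= andbT; split=> [/and4P[]|[-> -> -> ->]].
have E0 : sat w (nth N l 0) s <-> 0 < #|G| by rewrite /sat /= s0 lt0n.
have E1 : sat w (nth N l 1) s <-> forall u v : G, lazy_walk 6 u v.
  rewrite sat_allG //; split=> H u.
    by have := H u; rewrite sat_allG // => H' v; have /sat_walk := H' v; apply.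
  by rewrite sat_allG // => v; apply/sat_walk.
have E2 : sat w (nth N l 2) s <->
    forall u v, adj u v -> (u \in marked #|G|) != (v \in marked #|G|).
  rewrite sat_allG //.
  have K u v : sat w (Add (Not (adj_expr (Var 1) (Var 2)))
       (Not (Eq (side_expr (Var 1)) (side_expr (Var 2)))))
       (upd (upd s 1 (enum_rank u)) 2 (enum_rank v)) =
       (adj u v ==> ((u \in marked #|G|) != (v \in marked #|G|))).
    rewrite sat_or !sat_not sat_eqn (@sat_adj _ _ _ u v) //.
    rewrite (@eval_marked _ _ #|G| u); last by rewrite /= /upd /= s0.
    rewrite (@eval_marked _ _ #|G| v); last by rewrite /= /upd /= s0.
    by case: (adj u v); do 2!case: (_ \in _).
  split=> H u.
    by have := H u; rewrite sat_allG // => H' v; have := H' v; rewrite K => /implyP.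
  by rewrite sat_allG // => v; rewrite K; apply/implyP; apply: H.
have E3 : sat w (nth N l 3) s <-> efficient_dominating (marked 0).
  rewrite sat_allG //.
  have K v : sat w (Eq (Sum 2 N (Mul (near_expr (Var 1) (Var 2)) (dom_expr (Var 2)))) (Cst 1))
      (upd s 1 (enum_rank v)) = (#|closed_nbhd v :&: marked 0| == 1).
    rewrite sat_eqn eval_sumG //; congr (_ == _).
    rewrite -[RHS]sum1_card [RHS]big_mkcond /=; apply: eq_bigr => u _.
    set r := upd _ 2 _.
    rewrite -[LHS]/(eval w (near_expr (Var 1) (Var 2)) r * eval w (dom_expr (Var 2)) r).
    rewrite (@eval_near _ _ _ v u) // (@eval_marked _ _ 0 u); last first.
      by rewrite /= /r /upd /= s0 add0n.
    by rewrite in_setI [u \in closed_nbhd _]inE eq_sym -/(near v u); case: near; case: (u \in _).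
  by split=> H v; have := H v; rewrite K => /eqP.
by split=> [] [? ? ? ?]; (split; [exact/E0|exact/E1|exact/E2|exact/E3]).
Qed.

Lemma sat_shape s : s 0 = #|G| -> sat w shape_expr s.
Proof.
move=> s0; rewrite sat_conj /= andbT; apply/and5P; split; last apply/andP; try split.
- apply/sat_all => i /=; rewrite s0 => il; rewrite sat_sym /= /upd /= onth_pair_word.
  by rewrite size_encode ifT; [rewrite onth_cat size_nseq il onth_nseq il|lia].
- rewrite sat_sym /= s0 onth_pair_word size_encode ifT; last by lia.
  by rewrite onth_cat size_nseq ltnn subnn.
- apply/sat_all => i /=; rewrite s0 => il; rewrite sat_sym /= /upd /= s0 onth_pair_word.
  have l : #|G| + 1 + i < size (encode_graph G) by rewrite size_encode ltn_add2l.
  by rewrite l; move: (onthTE (encode_graph G) (#|G| + 1 + i)); rewrite l; case: onth.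
- by rewrite sat_sym /= s0 onth_pair_word size_encode ltnn eqxx.
- by rewrite sat_allG // => u; rewrite sat_not (@sat_adj _ _ _ u u) ?adj_irrefl.
- rewrite sat_allG // => u; rewrite sat_allG // => v.
  by rewrite sat_eqn (@eval_adj _ _ _ u v) ?(@eval_adj _ _ _ v u) // adj_sym.
Qed.

End Encoded.

Lemma shape_graph (x y : seq bool) s : sat (pair_word x y) shape_expr s ->
  exists G : sgraph, #|G| = s 0 /\ encode_graph G = x.
Proof.
set w := pair_word x y; set n := s 0.
rewrite sat_conj /= andbT => /and5P[/sat_all H1 H2 /sat_all H3 H4 /andP[/sat_all H5 /sat_all H6]].
have h1 i : i < n -> onth w i = Some (Some true).
  by move=> /H1; rewrite sat_sym /= /upd /= => /eqP.
have h2 : onth w n = Some (Some false) by move: H2; rewrite sat_sym /= => /eqP.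
have h3 i : i < n * n -> exists b, onth w (n + 1 + i) = Some (Some b).
  move=> /H3; rewrite sat_sym /= /upd /=.
  by case: (onth w _) => [[b|]|] // _; exists b.
have h4 : onth w (n + 1 + n * n) = Some None by move: H4; rewrite sat_sym /= => /eqP.
pose a i j := onth w (n + 1 + (i * n + j)) == Some (Some true).
have h5 i : i < n -> a i i = false.
  by move=> /H5; rewrite sat_not /sat /= /upd /= -/n -/(a i i); case: (a i i).
have h6 i j : i < n -> j < n -> a i j = a j i.
  move=> /H6/sat_all H /H; rewrite sat_eqn /= /upd /= -/n -/(a i j) -/(a j i).
  by do 2!case: (a _ _).
(* The only separator of [w] is at position [size x]: at n + 1 + n * n there is one by [h4], and at
   every earlier position a bit by [h1], [h2] and [h3]. *)
have sx : size x = n + 1 + n * n.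
  have hx i : onth w i = Some None -> size x <= i.
    by rewrite leqNgt onth_pair_word; case: ltnP => //; case: (onth x i).
  apply/eqP; rewrite eqn_leq hx //= leqNgt; apply/negP => l.
  have hw : onth w (size x) = Some None by rewrite onth_pair_word ltnn eqxx.
  case: (ltngtP (size x) n) => [/h1|l2|e]; first by rewrite hw.
  - have [|b] := h3 (size x - (n + 1)); first by lia.
    by rewrite subnKC ?hw //; lia.
  - by move: h2; rewrite -e hw.
have aS : symmetric (fun i j : 'I_n => a i j) by move=> i j; apply: h6.
have aI : irreflexive (fun i j : 'I_n => a i j) by move=> i; apply: h5.
exists (SGraph aS aI); split; first by rewrite card_ord.
apply: eq_from_onth_le => i; rewrite size_encode /= card_ord sx maxnn => il.
have wx b : onth w i = Some (Some b) -> onth x i = Some b.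
  by rewrite onth_pair_word sx il; case: (onth x i) => //= c [->].
rewrite onth_cat size_nseq /= card_ord; case: ltngtP => [l|l|e].
- by rewrite onth_nseq l (wx _ (h1 _ l)).
- have -> : i - n = (i - (n + 1)).+1 by lia.
  set k := i - (n + 1); have kl : k < n * n by rewrite /k; lia.
  have n0 : 0 < n by case: (n) kl.
  have [r1 r2] : k %/ n < n /\ k %% n < n by rewrite ltn_divLR // ltn_mod.
  have [b hb] := h3 k kl.
  have ei : i = n + 1 + k by rewrite /k; lia.
  rewrite (wx b) ?ei //=.
  have := @onth_allpairs _ _ _ (fun i j : 'I_n => a i j) (enum 'I_n) (enum 'I_n) (k %/ n) (k %% n).
  rewrite size_enum_ord -divn_eq => /(_ r2) ->.
  have o j (jl : j < n) : onth (enum 'I_n) j = Some (Ordinal jl).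
    rewrite onthE (nth_map (Ordinal jl)) ?size_enum_ord //.
    by congr Some; apply: ord_inj; rewrite nth_enum_ord.
  by rewrite (o _ r1) (o _ r2) /= /a -divn_eq hb; case: b {hb}.
- by rewrite (wx false) e ?subnn.
Qed.

Definition narrow_bipartite (G : sgraph) :=
  bipartite G /\ connected G /\ diameter G <= 6.

Lemma verifier_complete x :
  language (@restrict efficient_domination narrow_bipartite) x ->
  exists y, size y <= 2 * size x /\ sat (pair_word x y) verifier (fun=> 0).
Proof.
move=> [[G [[A bip] cd]] [/= <- [D eds]]].
have [G0 lw] := (connected_diameterP G 6).1 cd.
  (* The certificate lists the membership bits for [D], then those for the side [A]. *)
  pose y := [seq v \in D | v <- enum G] ++ [seq v \in A | v <- enum G].
  have sz (f : pred G) : size [seq f v | v <- enum G] = #|G| by rewrite size_map -cardE.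
  exists y; split.
    by rewrite size_cat !sz size_encode; lia.
  apply/sat_exists; exists #|G|.
    rewrite /= /pair_word size_cat size_map size_encode.
    by apply: leq_trans (leq_addr _ _); rewrite addn1 leq_addr.
  have mD : marked G y 0 = D.
    apply/setP=> v; rewrite inE onth_cat sz ltn_ord onth_map onth_enum_rank /=.
    by case: (v \in D).
  have mA : marked G y #|G| = A.
    apply/setP=> v; rewrite inE onth_cat sz ltnNge leq_addr /= addKn.
    by rewrite onth_map onth_enum_rank /=; case: (v \in A).
  by rewrite sat_and sat_shape //=; apply/sat_graph; rewrite ?mD ?mA.
Qed.

Lemma verifier_sound x y : sat (pair_word x y) verifier (fun=> 0) ->
  language (@restrict efficient_domination narrow_bipartite) x.
Proof.
move=> /sat_exists[n _]; rewrite sat_and => /andP[/shape_graph[G [nG <-]]].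
move=> /sat_graph => /(_ (esym nG)) [G0 lw bip eds].
have cG : narrow_bipartite G.
  by split; [exists (marked G y #|G|)|exact/connected_diameterP].
by exists (exist _ G cG); split=> //; exists (marked G y 0).
Qed.

Lemma efficient_domination_in_NP :
  in_NP (language (@restrict efficient_domination narrow_bipartite)).
Proof.
have [|p Hp] := @poly_bounded_horner (fun n => 2 * n); first by poly_tac.
exists (fun w => sat w verifier (fun=> 0)), p; split; first exact: expr_in_P.
move=> x; split=> [/verifier_complete[y [sy h]]|[y [_ /verifier_sound]]] //.
by exists y; split=> //; apply: leq_trans (Hp _).
Qed.

End Verifier.

(** * Exact covers and efficient domination *)

Lemma efficient_dominatingP (G : sgraph) (D : {set G}) :
  efficient_dominating D <->
  forall v, exists u, [/\ u \in D, near v u & forall u', u' \in D -> near v u' -> u' = u].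
Proof.
have mem v u : (u \in closed_nbhd v :&: D) = near v u && (u \in D).
  by rewrite in_setI [u \in closed_nbhd _]inE eq_sym.
split=> H v; last first.
  have [u [uD vu un]] := H v; apply/eqP/cards1P; exists u; apply/setP=> u'.
  rewrite mem inE; apply/andP/eqP => [[vu' u'D]|->] //; exact: un.
have /eqP/cards1P[u eu] := H v.
have : u \in closed_nbhd v :&: D by rewrite eu inE.
rewrite mem => /andP[vu uD]; exists u; split=> // u' u'D vu'.
by apply/set1P; rewrite -eu mem vu'.
Qed.

Section ExactCover.
Variables (E S : finType) (inc : E -> S -> bool).

Definition exact_cover (C : pred S) :=
  forall e, exists s, [/\ C s, inc e s & forall s', C s' -> inc e s' -> s' = s].

(* Elements, then sets, then one pendant vertex for each set. *)
Definition cover_adj (u v : E + (S + S)) : bool :=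
  match u, v with
  | inl e, inr (inl s) | inr (inl s), inl e => inc e s
  | inr (inl s), inr (inr s') | inr (inr s), inr (inl s') => s == s'
  | _, _ => false
  end.

Lemma cover_adj_sym : symmetric cover_adj.
Proof. by move=> [e|[s|s]] [e'|[s'|s']] //=; rewrite eq_sym. Qed.

Lemma cover_adj_irrefl : irreflexive cover_adj.
Proof. by move=> [e|[s|s]]. Qed.

Definition cover_graph := SGraph cover_adj_sym cover_adj_irrefl.

Lemma cover_graph_bipartite : bipartite cover_graph.
Proof.
exists [set v | if v is inr (inl _) then true else false].
by move=> [e|[s|s]] [e'|[s'|s']]; rewrite !inE.
Qed.

Hypothesis covered : forall e, exists s, inc e s.

Lemma cover_graph_dominating :
  (exists D : {set cover_graph}, efficient_dominating D) <-> exists C, exact_cover C.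
Proof.
split=> [[D /efficient_dominatingP eds]|[C cC]].
  (* Let a set [s] contain [e]. The vertex dominating the pendant of [s] is that pendant or [s], so
     it dominates [s] as well. If [e] were chosen, uniqueness at [s] would make this vertex equal to
     [e], which is not near the pendant. *)
  have notE e : (inl e : cover_graph) \notin D.
    apply/negP=> eD; have [s es] := covered e.
    have [x [xD sx ux]] := eds (inr (inr s)).
    have [z [_ _ uz]] := eds (inr (inl s)).
    have ez : inl e = z by apply: uz => //; rewrite /near /= es ?orbT.
    have : x = z.
      apply: uz => //; case: x sx {xD ux} => [e'|[s'|s']]; rewrite /near //=.
      - by move=> /eqP->; rewrite eqxx.
      - by rewrite orbF => /eqP[->].
    by move=> xz; move: sx; rewrite xz -ez.
  exists (fun s => inr (inl s) \in D) => e.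
  have [x [xD ex ux]] := eds (inl e).
  case: x xD ex ux => [e'|[s|s]] xD; rewrite /near //=.
  - by move: (notE e'); rewrite xD.
  - move=> es ux; exists s; split=> // s' s'D es'.
    by have := ux (inr (inl s')) s'D; rewrite /= es' => /(_ isT) [].
(* Take the sets of the cover, together with the pendants of all other sets. *)
exists [set v : cover_graph | match v with
  | inl _ => false | inr (inl s) => C s | inr (inr s) => ~~ C s end].
apply/efficient_dominatingP=> -[e|[s|s]].
- have [s [Cs es us]] := cC e; exists (inr (inl s)); split; rewrite ?inE //.
  by move=> [e'|[s'|s']]; rewrite inE // => Cs' es'; rewrite (us s').
- case Cs: (C s); [exists (inr (inl s))|exists (inr (inr s))];
    split; rewrite ?inE /near ?eqxx ?Cs //= ?eqxx //.
    move=> [e'|[s'|s']]; rewrite inE // => Cs'; first by rewrite orbF => /eqP[->].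
    by move=> /orP[/eqP//|/eqP ss]; rewrite -ss Cs in Cs'.
  move=> [e'|[s'|s']]; rewrite inE // => Cs'; last by move=> /orP[/eqP//|/eqP->].
  by rewrite orbF => /eqP[ss]; rewrite -ss Cs in Cs'.
- case Cs: (C s); [exists (inr (inl s))|exists (inr (inr s))];
    split; rewrite ?inE /near ?eqxx ?Cs //= ?eqxx ?orbT //.
    move=> [e'|[s'|s']]; rewrite inE // => Cs'; first by move=> /orP[/eqP//|/eqP->].
    by rewrite orbF => /eqP[ss]; rewrite -ss Cs in Cs'.
  move=> [e'|[s'|s']]; rewrite inE // => Cs'; last by rewrite orbF => /eqP[->].
  by move=> /orP[/eqP//|/eqP ss]; rewrite -ss Cs in Cs'.
Qed.

Variable hub : S.
Hypothesis meets_hub : forall s, exists2 e, inc e s & inc e hub.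

(* Every set is at distance at most 2 from the hub, hence every vertex at most 3. *)
Lemma cover_graph_diameter : connected cover_graph /\ diameter cover_graph <= 6.
Proof.
have setW s : @lazy_walk cover_graph 2 (inr (inl s)) (inr (inl hub)).
  have [e es eh] := meets_hub s.
  by exists (inl e); [rewrite /near /= es ?orbT|exists (inr (inl hub))]; rewrite /near /= ?eh ?orbT.
have W (v : cover_graph) : lazy_walk 3 v (inr (inl hub)).
  case: v => [e|[s|s]].
  - have [s es] := covered e; exists (inr (inl s)); last exact: setW.
    by rewrite /near /= es ?orbT.
  - exact: lazy_walk_leq (setW s).
  - by exists (inr (inl s)); [rewrite /near /= eqxx ?orbT|exact: setW].
apply/connected_diameterP; split.
  by apply/card_gt0P; exists (inr (inl hub)).
move=> u v; exact: lazy_walkD (W u) (lazy_walk_sym (W v)).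
Qed.

Lemma cover_graph_narrow : narrow_bipartite cover_graph.
Proof. by split; [exact: cover_graph_bipartite|exact: cover_graph_diameter]. Qed.

End ExactCover.

(** * Computations as tilings *)

Section Tableau.
Variable M : tm (option bool).
Local Notation sym := (option (option bool + work M)).
Local Notation syms := {ffun 'I_(ntapes M).+1 -> sym}.

(* The contents of one column of the tapes, and whether it is under the heads. *)
Definition column := (syms * bool)%type.
(* Three consecutive columns, the state and the scanned symbols. *)
Definition tile := (column * column * column * (state M * syms))%type.

Implicit Types (x : tile) (c : config M).
Definition left_col x : column := x.1.1.1.
Definition mid_col x : column := x.1.1.2.
Definition right_col x : column := x.1.2.

(** Horizontal neighbours overlap in two columns. The state and the scanned symbols are part of the
    colour, so they are constant along a row. *)
Definition hcolour := (column * column * (state M * syms))%type.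
Definition vcolour := (column * state M)%type.

Definition west x : hcolour := (left_col x, mid_col x, x.2).
Definition east x : hcolour := (mid_col x, right_col x, x.2).
Definition north x : vcolour := (mid_col x, x.2.1).
(** The heads stay in place and each tape slides under its own, so the new symbol on tape [i] comes
    from the left, middle or right column according to the move of head [i]. The written symbol
    replaces the old one if that source column was under the heads. *)
Definition south x : vcolour :=
  if halting x.2.1 then north x else
  let: (q, act) := delta x.2.1 x.2.2 in
  ([ffun i =>
      let y := match (act i).2 with
               | MoveLeft => left_col x | Stay => mid_col x | MoveRight => right_col x
               end in
      if y.2 then (act i).1 else y.1 i], (mid_col x).2, q).

(* Columns are counted from the heads. *)
Definition col c (z : int) : column := ([ffun i => view (c.2 i) z], z == 0%R).
Definition tile_of c (z : int) : tile :=
  (col c (z - 1)%R, col c z, col c (z + 1)%R, (c.1, [ffun i => scanned (c.2 i)])).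

Lemma south_tile_of c z : south (tile_of c z) = (col (step c) z, (step c).1).
Proof.
rewrite /south /step /=; case: ifP => // _.
case: (delta _ _) => q act /=; congr (_, _, _).
apply/ffunP=> i; rewrite !ffunE view_shift view_write.
by case: (act i) => a [] /=; rewrite ffunE ?addr0.
Qed.

Lemma nth_written (u : seq (option bool)) i :
  nth None (written M u) i = omap inl (onth u i).
Proof. by rewrite onthE /written; elim: u i => [|a u IH] [|i] //=. Qed.

Variables (w : seq bool) (m T W : nat).
Local Notation n := (size w).

(** Column [k] of row 0 holds [a] and its right neighbour holds [b]. The cells from [W] on contain
    [w] and the separator; the next [m] cells may hold any bits, which is where the certificate is
    guessed. There a blank must be followed by a blank, so the bits form a word. *)
Definition init_symbol k (a b : sym) : bool :=
  match a with
  | None => (k < W) || (W + n < k) && ((b == None) || (W + n + m < k))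
  | Some (inl (Some d)) => (W <= k) && (onth w (k - W) == Some d)
                           || (W + n < k) && (k <= W + n + m)
  | Some (inl None) => k == W + n
  | Some (inr _) => false
  end.

Definition allowed t k x : bool :=
  [&& (mid_col x).2 == (k == W), (mid_col x).2 ==> ((mid_col x).1 == x.2.2),
      (t == 0) ==> [&& x.2.1 == start M,
        [forall i, (i != ord0) ==> ((mid_col x).1 i == None)]
        & init_symbol k ((mid_col x).1 ord0) ((right_col x).1 ord0)]
    & (t == T) ==> accepting x.2.1].

Definition tiling (f : nat -> nat -> tile) :=
  [/\ forall t k, t <= T -> k <= W + W -> allowed t k (f t k),
      forall t k, t <= T -> k < W + W -> east (f t k) = west (f t k.+1)
    & forall t k, t < T -> k <= W + W -> south (f t k) = north (f t.+1 k)].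

Lemma view_init0 z :
  forall u i, view ((init M u).2 i) z =
    if i == ord0 then if z is Posz j then omap inl (onth u j) else None else None.
Proof.
move=> u i; rewrite view_init; case: eqP => // _; case: z => // j.
exact: nth_written.
Qed.

Lemma init_symbol_pair (y : seq bool) k : size y <= m ->
  let c z := view ((init M (pair_word w y)).2 ord0) z in
  init_symbol k (c (Posz k - Posz W)%R) (c (Posz k - Posz W + 1)%R).
Proof.
move=> ym; rewrite /= !view_init0 eqxx.
case: (ltnP k W) => kW.
  have -> : (Posz k - Posz W)%R = Negz (W - k).-1 by lia.
  by rewrite /= kW.
have -> : (Posz k - Posz W)%R = Posz (k - W) by lia.
have -> : (Posz (k - W) + 1)%R = Posz (k - W).+1 by lia.
rewrite !onth_pair_word.
case: ltngtP => [kn|kn|kn].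
- move: (onthTE w (k - W)); rewrite kn; case E: (onth w _) => [b|] //= _.
  by rewrite kW E eqxx.
- rewrite ltnNge (leqW (ltnW kn)) /= gtn_eqF ?leqW //.
  have WK : W + n < k by lia.
  case E: (onth y _) => [b|] /=.
    have : k - W - n.+1 < size y by rewrite -onthTE E.
    by rewrite WK => ky; rewrite (_ : k <= _) ?orbT //; lia.
  have : size y <= k - W - n.+1 by rewrite -onthNE E.
  move=> ky; rewrite onth_default ?WK ?orbT //=; lia.
- by rewrite /= -kn subnKC.
Qed.

Lemma tiling_of_run (y : seq bool) : size y <= m ->
  accepting (run M T (pair_word w y)).1 -> exists f, tiling f.
Proof.
move=> ym acc.
(* Column [W] of the rectangle is the column under the heads. *)
exists (fun t k => tile_of (run M t (pair_word w y)) (Posz k - Posz W)%R); split.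
- move=> t k tT kW; apply/and4P; split.
  + by rewrite /=; apply/eqP; apply/eqP/eqP; lia.
  + apply/implyP => /eqP /= ->; apply/eqP/ffunP=> i.
    by rewrite ffunE.
  + apply/implyP=> /eqP->; apply/and3P; split => //=.
      apply/forallP=> i; apply/implyP=> i0.
      by rewrite /= ffunE (view_init0 _ (pair_word w y)) (negbTE i0).
    rewrite /= [X in init_symbol _ X]ffunE [X in init_symbol _ _ X]ffunE.
    exact: init_symbol_pair.
  + by apply/implyP=> /eqP->.
- move=> t k _ _; rewrite /east /west /=; congr (col _ _, col _ _, _); lia.
- by move=> t k tT kW; rewrite south_tile_of.
Qed.

Lemma blank_suffix (f : nat -> option bool) k :
  (forall i, f i = None -> f i.+1 = None) -> f k = None ->
  exists2 y, size y <= k & forall i, f i = onth y i.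
Proof.
elim: k f => [|k IH] f H fk; last case f0: (f 0) => [b|].
- exists [::] => // i; rewrite onth0n.
  by elim: i => // i; apply: H.
- have [y yk fy] := IH (fun i => f i.+1) (fun i => H i.+1) fk.
  by exists (b :: y) => // -[|i] /=; rewrite ?f0 ?fy.
- exists [::] => // i; rewrite onth0n.
  by elim: i => // i; apply: H.
Qed.

(** The input with its longest certificate fits into row 0, and in [T] rows no error from the
    borders reaches column [W]. *)
Hypothesis W_large : n + m + T < W.

Section Soundness.
Variable f : nat -> nat -> tile.
Hypothesis f_tiling : tiling f.

Lemma tiling_init : exists2 y, size y <= m &
  forall k, k <= W + W -> mid_col (f 0 k) = col (init M (pair_word w y)) (Posz k - Posz W)%R.
Proof.
have [al ew _] := f_tiling.
pose a k := (mid_col (f 0 k)).1 ord0.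
have ak k : k <= W + W -> init_symbol k (a k) ((right_col (f 0 k)).1 ord0).
  by move=> /(al 0 _ (leq0n T)) /and4P[_ _ /implyP/(_ isT)/and3P[]].
have ra k : k < W + W -> (right_col (f 0 k)).1 ord0 = a k.+1.
  by move=> /(ew 0 _ (leq0n T)) [_ ->].
have noinr k s : k <= W + W -> a k <> Some (inr s).
  by move=> /ak + e; rewrite e.
have atsep k : k <= W + W -> a k = Some (inl None) -> k = W + n.
  by move=> /ak + e; rewrite e => /eqP.
have atbit k d : k <= W + W -> a k = Some (inl (Some d)) ->
    W <= k /\ onth w (k - W) = Some d \/ W + n < k <= W + n + m.
  move=> /ak + e; rewrite e /= => /orP[/andP[-> /eqP ->]|->]; first by left.
  by right.
have atblank k : k < W + W -> a k = None -> W <= k ->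
    W + n < k /\ (a k.+1 = None \/ W + n + m < k).
  move=> kW e Wk; have := ak _ (ltnW kW); rewrite e ra //= ltnNge Wk /=.
  by case/andP=> -> /orP[/eqP|]; [split=> //; left|split=> //; right].
(* The cells after the separator. The one with index [m] is beyond the certificate and cannot hold a
   bit, so the word read off has length at most [m]. *)
pose g i : option bool := if i <= m then
  if a (W + n + 1 + i) is Some (inl (Some b)) then Some b else None else None.
have [|| y ym gy] := @blank_suffix g m.
- move=> i; rewrite /g; case: (leqP i.+1 m) => im //; rewrite (ltnW im).
  have kW : W + n + 1 + i < W + W by lia.
  case E: (a (W + n + 1 + i)) => [[[b|]|s]|] // _.
  + by have := atsep _ (ltnW kW) E; lia.
  + by case: (noinr _ s (ltnW kW)).
  + have [|_ [e|]] := atblank _ kW E; try lia.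
    by rewrite addnS e.
- rewrite /g leqnn; case E: (a (W + n + 1 + m)) => [[[b|]|s]|] //.
  have kW : W + n + 1 + m <= W + W by lia.
  have [[_]|] := atbit _ b kW E; last by lia.
  by rewrite onth_default //; lia.
exists y => // k kW.
have [al1 _ _] := f_tiling.
have /and4P[/eqP h1 _ /implyP/(_ isT)/and3P[_ /forallP h2 _] _] := al1 0 k (leq0n T) kW.
rewrite (surjective_pairing (mid_col _)) h1 /col; congr pair; last by apply/eqP/eqP; lia.
apply/ffunP=> i; rewrite [RHS]ffunE (view_init0 _ (pair_word w y)).
case: eqP => [->|/eqP i0]; last by apply/eqP; apply: implyP i0; apply: h2.
rewrite -/(a k); case: (ltnP k W) => kW1.
  have -> : (Posz k - Posz W)%R = Negz (W - k).-1 by lia.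
  case E: (a k) => [[[b|]|s]|] //.
  - by have [[]|] := atbit _ b kW E; lia.
  - by have := atsep _ kW E; lia.
  - by case: (noinr _ s kW).
have -> : (Posz k - Posz W)%R = Posz (k - W) by lia.
rewrite onth_pair_word; case: (ltngtP (k - W) n) => kn.
- case E: (a k) => [[[b|]|s]|].
  + by have [[_ ->]|] := atbit _ b kW E; last lia.
  + by have := atsep _ kW E; lia.
  + by case: (noinr _ s kW).
  + by have [||] := atblank k _ E; lia.
- have ek : W + n + 1 + (k - W - n.+1) = k by lia.
  case E: (a k) => [[[b|]|s]|].
  + have [[_]|/andP[_ km]] := atbit _ b kW E; first by rewrite onth_default // ltnW.
    by rewrite -gy /g ek E ifT //; lia.
  + by have := atsep _ kW E; lia.
  + by case: (noinr _ s kW).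
  + case: (leqP (k - W - n.+1) m) => km; last by rewrite onth_default //; lia.
    by rewrite -gy /g ek E km.
- case E: (a k) => [[[b|]|s]|] //.
  + have [[_]|] := atbit _ b kW E; last by lia.
    by rewrite onth_default // kn.
  + by case: (noinr _ s kW).
  + by have [||] := atblank k _ E; lia.
Qed.

Lemma tiling_row t j k : t <= T -> j <= W + W -> k <= W + W -> (f t j).2 = (f t k).2.
Proof.
move=> tT; suff H i : i <= W + W -> (f t i).2 = (f t 0).2 by move=> /H-> /H->.
elim: i => // i IH iW; rewrite -IH; last exact: ltnW.
by have [_ /(_ t i tT iW) [_ _ ->]] := f_tiling.
Qed.

Lemma tiling_run (y : seq bool) :
  (forall k, k <= W + W -> mid_col (f 0 k) = col (init M (pair_word w y)) (Posz k - Posz W)%R) ->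
  accepting (run M T (pair_word w y)).1.
Proof.
move=> f0; have [al ew ns] := f_tiling.
pose c t := run M t (pair_word w y).
(* The tiles at both ends of row 0 are not controlled from outside; the error
   spreads by one column per row, so row t is right on the columns t to 2W - t. *)
have inv t : t <= T ->
    (forall k, t <= k -> k + t <= W + W -> mid_col (f t k) = col (c t) (Posz k - Posz W)%R) /\
    (f t W).2.1 = (c t).1.
  elim: t => [|t IH] tT.
    split=> [k _|]; first by rewrite addn0; apply: f0.
    by have /and4P[_ _ /implyP/(_ isT)/and3P[/eqP]] := al 0 W tT (leq_addr _ _).
  have [IH1 IH2] := IH (ltnW tT).
  (* Inside the safe zone a tile is determined: its side columns are the middle columns of its
     neighbours, and its state and scanned symbols are those of column [W], where [allowed] ties
     them to the tape. *)
  have tl k : t < k -> k + t < W + W -> f t k = tile_of (c t) (Posz k - Posz W)%R.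
    move=> tk kt.
    have fW : (f t W).2 = ((c t).1, [ffun i => scanned ((c t).2 i)]).
      have mW : mid_col (f t W) = col (c t) 0 by rewrite IH1; [congr col|..]; lia.
      have /and4P[_ /implyP h _ _] := al t W (ltnW tT) (leq_addr _ _).
      rewrite (surjective_pairing (f t W).2) IH2; congr pair.
      have /eqP <- : (mid_col (f t W)).1 == (f t W).2.2 by apply: h; rewrite mW.
      by rewrite mW; apply/ffunP=> i; rewrite !ffunE ?scanned_view.
    have m0 := IH1 k (ltnW tk) (ltnW kt).
    have m1 : right_col (f t k) = col (c t) (Posz k - Posz W + 1)%R.
      have kl : k < W + W by lia.
      have [_ -> _] := ew t k (ltnW tT) kl.
      by rewrite IH1; [congr col|..]; lia.
    have m2 : left_col (f t k) = col (c t) (Posz k - Posz W - 1)%R.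
      have kl : k.-1 < W + W by lia.
      have [e _ _] := ew t k.-1 (ltnW tT) kl.
      rewrite -[k in LHS](@prednK k) -?e; last by lia.
      by rewrite IH1; [congr col|..]; lia.
    have m3 : (f t k).2 = (f t W).2 by apply: tiling_row; lia.
    rewrite (surjective_pairing (f t k)) m3 fW.
    rewrite (surjective_pairing (f t k).1) (surjective_pairing (f t k).1.1).
    by rewrite -/(left_col _) -/(mid_col _) -/(right_col _) m0 m1 m2.
  have nx k : t < k -> k + t < W + W ->
      north (f t.+1 k) = (col (c t.+1) (Posz k - Posz W)%R, (c t.+1).1).
    move=> tk kt; rewrite -ns //; last by lia.
    by rewrite tl // south_tile_of.
  split=> [k tk kt|].
    have kt' : k + t < W + W by lia.
    by have [->] := nx k tk kt'.
  have [tW tW'] : t < W /\ W + t < W + W by lia.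
  by have [_ ->] := nx W tW tW'.
have [_ e] := inv T (leqnn T).
have /and4P[_ _ _ /implyP/(_ (eqxx T))] := al T W (leqnn T) (leq_addr _ _).
by rewrite e.
Qed.

End Soundness.

Lemma tilingP :
  (exists f, tiling f) <->
  (exists2 y, size y <= m & accepting (run M T (pair_word w y)).1).
Proof.
split=> [[f ft]|[y ym acc]]; last exact: tiling_of_run acc.
have [y ym f0] := tiling_init ft.
by exists y => //; apply: tiling_run f0.
Qed.

End Tableau.

(** * Tilings as exact covers *)

Section TilingCover.
Variable M : tm (option bool).
Variables (w : seq bool) (m T W : nat).
Local Notation tile := (tile M).
Local Notation allowed := (@allowed M w m T W).

(* Each cell has the elements [inl (inl h)] and [inl (inr v)] for the colours of
   its east and south edges, [inr None] that selects its tile, [inr (Some false)]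
   that excludes the unwanted sets, and [inr (Some true)] that belongs only to
   the set [inr false], which is thereby forced into every exact cover. *)
Definition elem : finType := ((hcolour M + vcolour M) + option bool)%type.

(* The sets [inr true] never occur in an exact cover; they contain almost every
   element, which keeps the diameter small. *)
Definition cset : finType := (tile + bool)%type.

(** The edges of the last column and the last row have no second tile, so there [inr false] covers
    all colours. *)
Definition member (t k : nat) (e : elem) (t' k' : nat) (s : cset) : bool :=
  match s, e with
  | inr true, _ => e != inr (Some true)
  | inr false, inr b => (b != None) && ((t == t') && (k == k'))
  | inr false, inl (inl _) => (k == W + W) && ((t == t') && (k == k'))
  | inr false, inl (inr _) => (t == T) && ((t == t') && (k == k'))
  | inl x, inr None => (t == t') && (k == k')
  | inl x, inr (Some b) => ~~ b && (~~ allowed t k x && ((t == t') && (k == k')))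
  | inl x, inl (inl h) =>
      (k < W + W) && (east x == h) && ((t == t') && (k == k'))
      || (west x != h) && ((t == t') && (k.+1 == k'))
  | inl x, inl (inr v) =>
      (t < T) && (south x == v) && ((t == t') && (k == k'))
      || (north x != v) && ((t.+1 == t') && (k == k'))
  end.

Definition cell := ('I_T.+1 * 'I_(W + W).+1)%type.
Definition inc (e : cell * elem) (s : cell * cset) : bool :=
  member e.1.1 e.1.2 e.2 s.1.1 s.1.2 s.2.

Lemma same_cell (p q : cell) :
  ((p.1 == q.1 :> nat) && (p.2 == q.2 :> nat)) = (p == q).
Proof. by []. Qed.

Lemma inc_covered e : exists s, inc e s.
Proof.
case: e => p e; have [->|ne] := eqVneq e (inr (Some true)).
  by exists (p, inr false); rewrite /inc /= !eqxx.
by exists (p, inr true).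
Qed.

(** A set [inr true] contains elements of all cells, so it meets each set within the cell of that
    set. *)
Lemma inc_hub (h : cell) s : exists2 e, inc e s & inc e (h, inr true).
Proof.
case: s => p [x|[]].
- by exists (p, inr None) => //; rewrite /inc /= !eqxx.
- by exists (p, inr None).
- by exists (p, inr (Some false)) => //; rewrite /inc /= !eqxx.
Qed.

Lemma tiling_of_cover C : exact_cover inc C -> exists f, @tiling M w m T W f.
Proof.
move=> cC.
have uniq e s s' : C s -> C s' -> inc e s -> inc e s' -> s = s'.
  by have [s0 [_ _ us]] := cC e; move=> Cs Cs' es es'; rewrite (us s) // (us s').
have CF p : C (p, inr false).
  have [[q s] [Cs es _]] := cC (p, inr (Some true)).
  move: es; rewrite /inc; case: s Cs => [x|[]] //= Cs.
  by rewrite same_cell => /eqP ->.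
(* Otherwise the element [inr (Some false)] would be covered by the forced set as well. *)
have nstar p : ~~ C (p, inr true).
  apply/negP=> Cs.
  have : (p, inr false) = (p, inr true) :> cell * cset.
    by apply: (uniq (p, inr (Some false))) => //; rewrite /inc /= !eqxx.
  by case.
have /fin_all_exists[f fC] p : exists x, C (p, inl x).
  have [[q s] [Cs es _]] := cC (p, inr None).
  move: es; rewrite /inc; case: s Cs => [x|[]] //= Cs.
    by rewrite same_cell => /eqP ->; exists x.
  by move: (nstar q); rewrite Cs.
exists (fun t k => f (inord t, inord k)); split=> t k tT kW.
- pose p : cell := (inord t, inord k).
  (* A tile that is not allowed would cover [inr (Some false)] together with the forced set. *)
  apply/negPn/negP=> na.
  have : (p, inr false) = (p, inl (f p)) :> cell * cset.
    apply: (uniq (p, inr (Some false))) => //; rewrite /inc /= ?eqxx //.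
    by rewrite !inordK // na.
  by case.
- pose p : cell := (inord t, inord k); pose q : cell := (inord t, inord k.+1).
  apply/eqP/negPn/negP; rewrite eq_sym => ne.
  have : (p, inl (f p)) = (q, inl (f q)) :> cell * cset.
    (* If the colours differ, the eastern colour of [p] is also covered by the tile of [q]. *)
    apply: (uniq (p, inl (inl (east (f p))))) => //; rewrite /inc /= !inordK ?eqxx ?kW ?ltnS //.
    + by rewrite (ltnW kW).
    + by apply/orP; right; rewrite !andbT; exact: ne.
    + by rewrite ltnW.
  case=> /(congr1 val); rewrite /= !inordK ?ltnS //; last by rewrite ltnW.
  by move=> /eqP; rewrite -(addn1 k) -[X in X == _]addn0 eqn_add2l.
- pose p : cell := (inord t, inord k); pose q : cell := (inord t.+1, inord k).
  apply/eqP/negPn/negP; rewrite eq_sym => ne.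
  have : (p, inl (f p)) = (q, inl (f q)) :> cell * cset.
    apply: (uniq (p, inl (inr (south (f p))))) => //; rewrite /inc /= !inordK ?eqxx ?tT ?ltnS //.
    + by rewrite (ltnW tT).
    + by apply/orP; right; rewrite !andbT; exact: ne.
    + by rewrite ltnW.
  case=> /(congr1 val); rewrite /= !inordK ?ltnS //; last by rewrite ltnW.
  by move=> /eqP; rewrite -(addn1 t) -[X in X == _]addn0 eqn_add2l.
Qed.

Lemma cover_of_tiling f : @tiling M w m T W f -> exists C, exact_cover inc C.
Proof.
move=> [al ew ns].
(* The tile of each cell and all the forced sets [inr false]. *)
pose C (s : cell * cset) := match s.2 with
  | inl x => x == f s.1.1 s.1.2 | inr b => ~~ b end.
exists C => -[[i j] e].
have iT : i <= T by rewrite -ltnS.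
have jW : j <= W + W by rewrite -ltnS.
have cellE (p : cell) : (i == p.1 :> nat) && (j == p.2 :> nat) -> p = (i, j).
  by rewrite (same_cell (i, j)) => /eqP.
case: e => [[h|v]|[[|]|]].
- have [jm|jn] := eqVneq (j : nat) (W + W).
    exists ((i, j), inr false); split; [by []|by rewrite /inc /= jm !eqxx|].
    move=> [p [x|[]]] //= _; rewrite /inc /=; last by case/andP=> _ /cellE->.
    rewrite jm ltnn /= => /and3P[_ _ /eqP e].
    by have := ltn_ord p.2; rewrite -e ltnn.
  have jl : j < W + W by rewrite ltn_neqAle jn.
  (* The own colour of the edge is covered from this cell, every other colour from the next cell. *)
  have [hh|hh] := eqVneq (east (f i j)) h.
    exists ((i, j), inl (f i j)); split; [by rewrite /C /=|by rewrite /inc /= hh jl !eqxx|].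
    move=> [p [x|[]]] //= => [/eqP->|_]; rewrite /inc /=; last by rewrite (negbTE jn).
    case/orP=> [/andP[_ /cellE->]|] //.
    case/and3P=> nh /eqP ei /eqP ej; case/negP: nh.
    by rewrite -ei -ej -hh (ew _ _ iT jl).
  have j1 : j.+1 < (W + W).+1 by [].
  exists ((i, Ordinal j1), inl (f i j.+1)); split.
  - by rewrite /C /=.
  - by rewrite /inc /= -(ew _ _ iT jl) hh !eqxx orbT.
  move=> [p [x|[]]] //= => [/eqP->|_]; rewrite /inc /=; last by rewrite (negbTE jn).
  case/orP=> [/andP[/andP[_ /eqP he] /cellE pe]|].
    by rewrite pe /= in he; rewrite he eqxx in hh.
  case/and3P=> _ /eqP ei /eqP ej; case: p ei ej => p1 p2 /= ei ej.
  by congr (_, _, inl (f _ _)) => //; apply: val_inj.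
- have [im|ni] := eqVneq (i : nat) T.
    exists ((i, j), inr false); split; [by []|by rewrite /inc /= im !eqxx|].
    move=> [p [x|[]]] //= _; rewrite /inc /=; last by case/andP=> _ /cellE->.
    rewrite im ltnn /= => /and3P[_ /eqP e _].
    by have := ltn_ord p.1; rewrite -e ltnn.
  have il : i < T by rewrite ltn_neqAle ni.
  have [hh|hh] := eqVneq (south (f i j)) v.
    exists ((i, j), inl (f i j)); split; [by rewrite /C /=|by rewrite /inc /= hh il !eqxx|].
    move=> [p [x|[]]] //= => [/eqP->|_]; rewrite /inc /=; last by rewrite (negbTE ni).
    case/orP=> [/andP[_ /cellE->]|] //.
    case/and3P=> nh /eqP ei /eqP ej; case/negP: nh.
    by rewrite -ei -ej -hh (ns _ _ il jW).
  have i1 : i.+1 < T.+1 by [].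
  exists ((Ordinal i1, j), inl (f i.+1 j)); split.
  - by rewrite /C /=.
  - by rewrite /inc /= -(ns _ _ il jW) hh !eqxx orbT.
  move=> [p [x|[]]] //= => [/eqP->|_]; rewrite /inc /=; last by rewrite (negbTE ni).
  case/orP=> [/andP[/andP[_ /eqP he] /cellE pe]|].
    by rewrite pe /= in he; rewrite he eqxx in hh.
  case/and3P=> _ /eqP ei /eqP ej; case: p ei ej => p1 p2 /= ei ej.
  by congr (_, _, inl (f _ _)) => //; apply: val_inj.
- exists ((i, j), inr false); split; rewrite /inc //= ?eqxx //.
  by move=> [p [x|[]]] //= _ /cellE->.
- exists ((i, j), inr false); split; rewrite /inc //= ?eqxx //.
  move=> [p [x|[]]] //= => [/eqP->|_ /cellE->] //.
  by case/andP=> na /cellE pe; move: na; rewrite pe /= al.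
- exists ((i, j), inl (f i j)); split; rewrite /inc /C //= ?eqxx //.
  by move=> [p [x|[]]] //= /eqP-> /cellE->.
Qed.

Definition tableau_graph := cover_graph inc.

Lemma tableau_graph_narrow : narrow_bipartite tableau_graph.
Proof.
apply: (@cover_graph_narrow _ _ _ inc_covered ((ord0, ord0), inr true)).
exact: inc_hub.
Qed.

Lemma tableau_graph_dominating : size w + m + T < W ->
  (exists D : {set tableau_graph}, efficient_dominating D) <->
  (exists2 y, size y <= m & accepting (run M T (pair_word w y)).1).
Proof.
move=> lW; split=> [/(cover_graph_dominating inc_covered)[C cC]|h].
  by apply/(tilingP M lW); apply: tiling_of_cover cC.
apply/(cover_graph_dominating inc_covered).
by have [f /cover_of_tiling] := (tilingP M lW).2 h.
Qed.

End TilingCover.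

(** * The reduction *)

Fixpoint horner_expr (S : Type) (l : seq nat) (e : expr S) : expr S :=
  if l is a :: l' then Add (Mul (horner_expr l' e) e) (Cst a) else Cst 0.

Lemma eval_horner (S : Type) w (p : {poly nat}) (e : expr S) s :
  eval w (horner_expr p e) s = horner p (eval w e s).
Proof. by rewrite /horner; elim: (polyseq p) => //= a l ->. Qed.

(** Coefficients are natural numbers; monotonicity lets one time bound serve certificates of all
    lengths. *)
Lemma leq_horner (p : {poly nat}) a b : a <= b -> horner p a <= horner p b.
Proof.
move=> ab; rewrite /horner; elim: (polyseq p) => //= c l IH.
by apply: leq_add => //; apply: leq_mul.
Qed.

Lemma enum_sum (A B : finType) :
  enum {: A + B} = [seq inl x | x <- enum A] ++ [seq inr x | x <- enum B].
Proof. by rewrite !enumT [in LHS]unlock. Qed.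

Lemma enum_prod (A B : finType) :
  enum {: A * B} = [seq (x, y) | x <- enum A, y <- enum B].
Proof. by rewrite [LHS]enumT [in LHS]unlock. Qed.

Lemma flatten_allpairs (A B : Type) (C : Type) (F : A * B -> seq C) s t :
  flatten [seq F x | x <- [seq (a, b) | a <- s, b <- t]] =
  flatten [seq flatten [seq F (a, b) | b <- t] | a <- s].
Proof.
elim: s => //= a s IH; rewrite map_cat flatten_cat IH -map_comp.
by [].
Qed.

Lemma map_enum_ord (C : Type) n (h : nat -> C) :
  [seq h i | i : 'I_n <- enum 'I_n] = [seq h i | i <- iota 0 n].
Proof. by rewrite -val_enum_ord -map_comp. Qed.

(** Index types that depend on the machine but not on the input are unrolled into the program
    text. *)
Definition gall (I : finType) (g : I -> gen) : gen :=
  foldr GCat GNil [seq g i | i <- enum I].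

Lemma gout_gall w (I : finType) (g : I -> gen) s :
  gout w (gall g) s = flatten [seq gout w (g i) s | i <- enum I].
Proof. by rewrite /gall; elim: (enum I) => //= i l ->. Qed.

Section GraphGenerator.
Variable M : tm (option bool).
Local Notation elem := (elem M).
Local Notation cset := (cset M).
Variables (last_row centre sep_pos last_pos : expr bool).
Local Notation last_col := (Add centre centre).

Definition gcells t k (g : gen) : gen :=
  GFor t (Add last_row (Cst 1)) (GFor k (Add last_col (Cst 1)) g).

(** The nesting of the loops follows the order of [enum] on sums and products, since the output must
    be the very word [encode_graph]. *)
Definition gverts t k (fe : elem -> gen) (fs fp : cset -> gen) : gen :=
  GCat (gcells t k (gall fe)) (GCat (gcells t k (gall fs)) (gcells t k (gall fp))).

Definition Leq (a b : expr bool) := Lt a (Add b (Cst 1)).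

Definition same_expr t k t' k' : expr bool :=
  Mul (Eq (Var t) (Var t')) (Eq (Var k) (Var k')).

Definition init_expr (k : nat) (a b : option (option bool + work M)) : expr bool :=
  match a with
  | None => Add (Lt (Var k) centre)
      (Mul (Lt sep_pos (Var k)) (Add (Cst (b == None)) (Lt last_pos (Var k))))
  | Some (inl (Some d)) =>
      Add (Mul (Leq centre (Var k)) (Sym (pred1 (Some d)) (Monus (Var k) centre)))
          (Mul (Lt sep_pos (Var k)) (Leq (Var k) last_pos))
  | Some (inl None) => Eq (Var k) sep_pos
  | Some (inr _) => Cst 0
  end.

Definition allowed_expr t k (x : tile M) : expr bool :=
  Conj [::
    if (mid_col x).2 then Eq (Var k) centre else Not (Eq (Var k) centre);
    Cst ((mid_col x).2 ==> ((mid_col x).1 == x.2.2));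
    Add (Not (Eq (Var t) (Cst 0)))
      (Mul (Cst ((x.2.1 == start M) &&
                 [forall i, (i != ord0) ==> ((mid_col x).1 i == None)]))
           (init_expr k ((mid_col x).1 ord0) ((right_col x).1 ord0)));
    Add (Not (Eq (Var t) last_row)) (Cst (accepting x.2.1))].

Definition member_expr t k (e : elem) t' k' (s : cset) : expr bool :=
  match s, e with
  | inr true, _ => Cst (e != inr (Some true))
  | inr false, inr b => Mul (Cst (b != None)) (same_expr t k t' k')
  | inr false, inl (inl _) => Mul (Eq (Var k) last_col) (same_expr t k t' k')
  | inr false, inl (inr _) => Mul (Eq (Var t) last_row) (same_expr t k t' k')
  | inl x, inr None => same_expr t k t' k'
  | inl x, inr (Some b) =>
      Mul (Cst (~~ b)) (Mul (Not (allowed_expr t k x)) (same_expr t k t' k'))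
  | inl x, inl (inl h) =>
      Add (Mul (Mul (Lt (Var k) last_col) (Cst (east x == h))) (same_expr t k t' k'))
          (Mul (Cst (west x != h))
               (Mul (Eq (Var t) (Var t')) (Eq (Add (Var k) (Cst 1)) (Var k'))))
  | inl x, inl (inr v) =>
      Add (Mul (Mul (Lt (Var t) last_row) (Cst (south x == v))) (same_expr t k t' k'))
          (Mul (Cst (north x != v))
               (Mul (Eq (Add (Var t) (Cst 1)) (Var t')) (Eq (Var k) (Var k'))))
  end.

Definition GZero : gen := GEmit (Cst 0).
Definition GOne : gen := GEmit (Cst 1).
Definition pendant_gen (s s' : cset) : gen :=
  GEmit (Mul (same_expr 0 1 2 3) (Cst (s == s'))).

(** Variables 0 and 1 run over the cell of the row vertex, 2 and 3 over that of the column
    vertex. *)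
Definition graph_gen : gen :=
  GCat (gverts 0 1 (fun=> GOne) (fun=> GOne) (fun=> GOne)) (GCat GZero
    (gverts 0 1
      (fun e => gverts 2 3 (fun=> GZero) (fun s => GEmit (member_expr 0 1 e 2 3 s)) (fun=> GZero))
      (fun s => gverts 2 3 (fun e => GEmit (member_expr 2 3 e 0 1 s)) (fun=> GZero) (pendant_gen s))
      (fun s => gverts 2 3 (fun=> GZero) (pendant_gen s) (fun=> GZero)))).

Variables (w : seq bool) (m T W : nat).
Hypothesis row_eq : forall s, eval w last_row s = T.
Hypothesis centre_eq : forall s, eval w centre s = W.
Hypothesis sep_eq : forall s, eval w sep_pos s = W + size w.
Hypothesis pos_eq : forall s, eval w last_pos s = W + size w + m.
Local Notation cell := (cell T W).
Local Notation graph := (tableau_graph M w m T W).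

Lemma sat_leq a b s : sat w (Leq a b) s = (eval w a s <= eval w b s).
Proof. by rewrite sat_lt /= addn1 ltnS. Qed.

Lemma sat_same t k t' k' s :
  sat w (same_expr t k t' k') s = (s t == s t') && (s k == s k').
Proof. by rewrite sat_and !sat_eqn. Qed.

Lemma sat_init k a b s : sat w (init_expr k a b) s = init_symbol w m W (s k) a b.
Proof.
case: a => [[[d|]|c]|] /=.
- by rewrite sat_or !sat_and !sat_leq sat_sym sat_lt /= centre_eq sep_eq pos_eq.
- by rewrite sat_eqn /= sep_eq.
- by [].
- by rewrite sat_or sat_and sat_or !sat_lt sat_cst /= centre_eq sep_eq pos_eq.
Qed.

Lemma sat_allowed t k x s : sat w (allowed_expr t k x) s = allowed w m T W (s t) (s k) x.
Proof.
rewrite sat_conj /= andbT /allowed; congr [&& _, _, _ & _].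
- by case: (mid_col x).2; rewrite ?sat_not sat_eqn /= centre_eq; case: (_ == _).
- by rewrite sat_cst.
- rewrite sat_or sat_not sat_eqn sat_and sat_cst sat_init -andbA.
  by case: (_ == 0).
- by rewrite sat_or sat_not sat_eqn sat_cst row_eq; case: (_ == T).
Qed.

Lemma sat_member t k e t' k' c s :
  sat w (member_expr t k e t' k' c) s = member w m T W (s t) (s k) e (s t') (s k') c.
Proof.
case: c => [x|[]]; case: e => [[h|v]|[b|]]; rewrite [member_expr _ _ _ _ _ _]/=.
- rewrite sat_or [X in X || _]sat_and [X in X && _ || _]sat_and.
  rewrite [X in _ || X]sat_and [X in _ || _ && X]sat_and.
  by rewrite sat_same sat_lt !sat_cst !sat_eqn /= centre_eq addn1.
- rewrite sat_or [X in X || _]sat_and [X in X && _ || _]sat_and.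
  rewrite [X in _ || X]sat_and [X in _ || _ && X]sat_and.
  by rewrite sat_same sat_lt !sat_cst !sat_eqn /= row_eq addn1.
- by rewrite sat_and [X in _ && X]sat_and sat_same sat_cst sat_not sat_allowed.
- exact: sat_same.
- exact: (sat_cst w true s).
- exact: (sat_cst w true s).
- exact: sat_cst.
- exact: (sat_cst w true s).
- by rewrite sat_and sat_same sat_eqn /= centre_eq.
- by rewrite sat_and sat_same sat_eqn /= row_eq.
- by rewrite sat_and sat_same.
- by rewrite sat_and sat_same.
Qed.

Lemma gout_gcells (I : finType) (g : I -> gen) t k s (F : cell * I -> seq bool) :
  (forall p i, gout w (g i) (upd (upd s t (p.1 : 'I__)) k (p.2 : 'I__)) = F (p, i)) ->
  gout w (gcells t k (gall g)) s = flatten [seq F x | x <- enum {: cell * I}].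
Proof.
move=> H; rewrite enum_prod flatten_allpairs enum_prod flatten_allpairs /= row_eq !addn1.
rewrite -(map_enum_ord T.+1); congr flatten; apply: eq_map => i.
rewrite !centre_eq addn1 -(map_enum_ord (W + W).+1); congr flatten; apply: eq_map => j.
by rewrite gout_gall; congr flatten; apply: eq_map => x; rewrite -H.
Qed.

Lemma gout_gverts t k (fe : elem -> gen) (fs fp : cset -> gen) s (F : graph -> seq bool) :
  (forall p e, gout w (fe e) (upd (upd s t (p.1 : 'I__)) k (p.2 : 'I__)) = F (inl (p, e))) ->
  (forall p c, gout w (fs c) (upd (upd s t (p.1 : 'I__)) k (p.2 : 'I__)) = F (inr (inl (p, c)))) ->
  (forall p c, gout w (fp c) (upd (upd s t (p.1 : 'I__)) k (p.2 : 'I__)) = F (inr (inr (p, c)))) ->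
  gout w (gverts t k fe fs fp) s = flatten [seq F v | v <- enum graph].
Proof.
move=> He Hs Hp; rewrite !enum_sum !map_cat !flatten_cat.
rewrite -[LHS]/(gout w (gcells t k (gall fe)) s ++
  (gout w (gcells t k (gall fs)) s ++ gout w (gcells t k (gall fp)) s)).
rewrite (@gout_gcells _ fe t k s (fun x => F (inl x)) He).
rewrite (@gout_gcells _ fs t k s (fun x => F (inr (inl x))) Hs).
rewrite (@gout_gcells _ fp t k s (fun x => F (inr (inr x))) Hp).
by congr (flatten _ ++ (flatten _ ++ flatten _)); rewrite -[RHS]map_comp // -[RHS]map_comp.
Qed.

Lemma gout_cat g h s : gout w (GCat g h) s = gout w g s ++ gout w h s.
Proof. by []. Qed.

Lemma gout_emit e s : gout w (GEmit e) s = [:: sat w e s].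
Proof. by []. Qed.

Lemma gout_pendant (p q : cell) (c c' : cset) s :
  gout w (pendant_gen c c')
    (upd (upd (upd (upd s 0 (p.1 : 'I__)) 1 (p.2 : 'I__)) 2 (q.1 : 'I__)) 3 (q.2 : 'I__)) =
  [:: (p, c) == (q, c')].
Proof.
by rewrite gout_emit sat_and sat_same sat_cst.
Qed.

Lemma gout_graph : gout w graph_gen (fun=> 0) = encode_graph graph.
Proof.
rewrite /graph_gen gout_cat gout_cat -[RHS]/(nseq #|graph| true ++ ([:: false] ++
  [seq adj x y | x <- enum graph, y <- enum graph])).
congr (_ ++ (_ ++ _)).
  rewrite (@gout_gverts _ _ _ _ _ _ (fun=> [:: true])) // flatten_map1.
  by rewrite cardE; elim: (enum _) => //= v l ->.
rewrite (@gout_gverts _ _ _ _ _ _ (fun u => [seq adj u v | v <- enum graph])) //.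
- move=> p e; pose u : graph := inl (p, e).
  rewrite (@gout_gverts _ _ _ _ _ _ (fun v => [:: adj u v])) ?flatten_map1 //.
  by move=> q c; rewrite gout_emit sat_member /upd.
- move=> p c; pose u : graph := inr (inl (p, c)).
  rewrite (@gout_gverts _ _ _ _ _ _ (fun v => [:: adj u v])) ?flatten_map1 //.
  + by move=> q e; rewrite gout_emit sat_member /upd.
  + by move=> q c'; rewrite gout_pendant.
- move=> p c; pose u : graph := inr (inr (p, c)).
  rewrite (@gout_gverts _ _ _ _ _ _ (fun v => [:: adj u v])) ?flatten_map1 //.
  by move=> q c'; rewrite gout_pendant.
Qed.

End GraphGenerator.

Lemma reduction (L : seq bool -> Prop) : in_NP L ->
  reduces_to L (@restrict efficient_domination narrow_bipartite).
Proof.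
move=> [R [q [[M [p dec]] LR]]].
pose m := horner_expr q (@Len bool).
(* The time that the verifier needs on the longest pair word; [W] is then the least width with
   [W_large]. *)
pose T := horner_expr p (Add (Add Len (Cst 1)) m).
pose W := Add (Add (Add Len m) T) (Cst 1).
pose sep := Add W Len.
pose last := Add sep m.
exists (fun w => gout w (graph_gen M T W sep last) (fun=> 0)); split; first exact: gen_poly_time.
move=> w; pose n := size w; pose mn := horner q n.
pose Tn := horner p (n + 1 + mn)%N; pose Wn := n + mn + Tn + 1.
have em s : eval w m s = mn by rewrite eval_horner.
have eT s : eval w T s = Tn by rewrite eval_horner /= em.
have eW s : eval w W s = Wn by rewrite /= em eT.
have es s : eval w sep s = Wn + n by rewrite -[LHS]/(eval w W s + n) eW.
have el s : eval w last s = Wn + n + mn.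
  by rewrite -[LHS]/(eval w sep s + eval w m s) es em.
pose G := tableau_graph M w mn Tn Wn.
exists (exist _ G (tableau_graph_narrow M w mn Tn Wn)); split.
  by rewrite (gout_graph M eT eW es el).
rewrite LR; apply: iff_sym; apply: (iff_trans (tableau_graph_dominating M _)).
  by rewrite /Wn; lia.
(* On a shorter certificate the machine halts earlier and its configuration stays fixed, so the
   verdict can be read at time [Tn]. *)
have run_acc y : size y <= mn ->
    accepting (run M Tn (pair_word w y)).1 <-> R (pair_word w y).
  move=> ym; have [h <-] := dec (pair_word w y).
  rewrite (run_halting _ h) //; apply: leq_horner.
  by rewrite /pair_word size_cat /= !size_map -addnA leq_add2l add1n ltnS.
by split=> [[y ym /(run_acc y ym) ry]|[y [ym /(run_acc y ym) ry]]]; exists y.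
Qed.

Theorem theorem15 :
  NP_complete
    (@restrict efficient_domination
       (fun G : sgraph => bipartite G /\ connected G /\ diameter G <= 6)).
Proof. by split; [exact: efficient_domination_in_NP|exact: reduction]. Qed.
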